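(* Let $d\ge1$, $0<\gamma<1$, $M,Q\in\mathbb R^{d\times d}$, $\rho,v\in\mathbb R^d$, and $K=\operatorname{diag}(K_1,\dots,K_d)$ with $K_1=\dots=K_d\in L^2_{\mathrm{loc}}(\mathbb R_+,\mathbb R)$. Set $$\tilde M=M+\frac{\gamma}{1-\gamma}Q^\top\rho v^\top,\qquad\tilde Q^\top\tilde Q=Q^\top Q+\frac{\gamma}{1-\gamma}Q^\top\rho\rho^\top Q,\qquad\tilde\Gamma=\frac{\gamma}{2(1-\gamma)}vv^\top.$$ Then the $\mathbb R^{d\times d}$-valued matrix Riccati–Volterra equation $$\psi(t)=\int_0^tf(\psi)(t-s)K(s)\,ds,\qquad f(\psi)=\psi\tilde M+\tilde M^\top\psi+2\psi\tilde Q^\top\tilde Q\psi+\tilde\Gamma,$$ has a unique non-continuable continuous solution $(\psi,T_{\max})$.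
   Context: $f(\psi)$ is evaluated pointwise: $f(\psi)(u)=f(\psi(u))$. A non-continuable solution of $\psi(t)=\int_0^tf(\psi)(t-s)K(s)ds$ is a pair $(\psi,T_{\max})$, $T_{\max}\in(0,\infty]$, with $\|\psi\|_{L^2[0,T]}<\infty$ for every $T<T_{\max}$, $\psi$ satisfying the equation on $[0,T_{\max})$, and $\|\psi\|_{L^2[0,T_{\max}]}=\infty$ if $T_{\max}<\infty$. It is unique if for any $T>0$ and any $\tilde\psi$ with $\|\tilde\psi\|_{L^2[0,T]}<\infty$ satisfying the equation on $[0,T]$ one has $T<T_{\max}$ and $\tilde\psi=\psi$ on $[0,T]$. *)

(* Defs.v *)
From HB Require Import structures.
From mathcomp Require Import all_boot all_order all_algebra.
From mathcomp Require Import ring lra.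
From mathcomp Require Import all_classical all_reals all_analysis.

Set Implicit Arguments.
Unset Strict Implicit.
Unset Printing Implicit Defensive.

Import Order.TTheory GRing.Theory Num.Theory.
Import numFieldNormedType.Exports.

Local Open Scope classical_set_scope.
Local Open Scope ring_scope.

Definition frobenius (R : realType) (d : nat) (A : 'M[R]_d) : R :=
  Num.sqrt (\sum_i \sum_j A i j ^+ 2).

Definition L2norm_on (R : realType) (D : set R) (h : R -> R) : \bar R :=
  ('N[@lebesgue_measure R]_(2%:E)[EFin \o (h \_ D)])%E.

Definition in_L2 (R : realType) (D : set R) (h : R -> R) : Prop :=
  measurable_fun D h /\ (L2norm_on D h < +oo)%E.

Definition mxL2norm_on (R : realType) (d : nat) (D : set R)
    (psi : R -> 'M[R]_d) : \bar R :=
  L2norm_on D (fun t => frobenius (psi t)).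

Definition mx_in_L2 (R : realType) (d : nat) (D : set R)
    (psi : R -> 'M[R]_d) : Prop :=
  (forall i j, measurable_fun D (fun t => psi t i j)) /\
  (mxL2norm_on D psi < +oo)%E.

(* The equation at the time t. Since Rintegral is a total operator, the
   existence of the (entrywise) integral is required separately. *)
Definition volterra_at (R : realType) (d : nat) (f : 'M[R]_d -> 'M[R]_d)
    (K : R -> 'M[R]_d) (psi : R -> 'M[R]_d) (t : R) : Prop :=
  (forall i j, (@lebesgue_measure R).-integrable `[0, t]
     (fun s => ((f (psi (t - s)) *m K s) i j)%:E)) /\
  psi t = \matrix_(i, j)
    (\int[@lebesgue_measure R]_(s in `[0, t]) ((f (psi (t - s)) *m K s) i j)).

(* Solutions are total functions on R of which only the values on
   [0, Tmax) are relevant; in the last clause the end point Tmax of the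
   closed interval is a null set. *)
Definition noncontinuable_solution (R : realType) (d : nat)
    (f : 'M[R]_d -> 'M[R]_d) (K : R -> 'M[R]_d)
    (psi : R -> 'M[R]_d) (Tmax : \bar R) : Prop :=
  [/\ (0 < Tmax)%E,
      forall T : R, 0 < T -> (T%:E < Tmax)%E -> mx_in_L2 `[0, T] psi,
      forall t : R, 0 <= t -> (t%:E < Tmax)%E -> volterra_at f K psi t &
      forall T : R, Tmax = T%:E -> mxL2norm_on `[0, T] psi = +oo%E].

(* The competitor psi' is an element of L^2[0, T], so the equation is only
   required almost everywhere on [0, T]. The conclusion covers both readings
   of "psi' = psi on [0, T]": equality almost everywhere, and equality at
   every time at which psi' satisfies the equation (hence on all of [0, T]
   when psi' satisfies it there pointwise). *)
Definition unique_solution (R : realType) (d : nat)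
    (f : 'M[R]_d -> 'M[R]_d) (K : R -> 'M[R]_d)
    (psi : R -> 'M[R]_d) (Tmax : \bar R) : Prop :=
  forall (T : R) (psi' : R -> 'M[R]_d), 0 < T ->
    mx_in_L2 `[0, T] psi' ->
    {ae @lebesgue_measure R, forall t, t \in `[0, T] -> volterra_at f K psi' t} ->
    [/\ (T%:E < Tmax)%E,
        {ae @lebesgue_measure R, forall t, t \in `[0, T] -> psi' t = psi t} &
        forall t, t \in `[0, T] -> volterra_at f K psi' t -> psi' t = psi t].

Definition continuous_until (R : realType) (d : nat)
    (psi : R -> 'M[R]_d) (Tmax : \bar R) : Prop :=
  {within [set t : R | 0 <= t /\ (t%:E < Tmax)%E], continuous psi}.

Definition riccati (R : realType) (d : nat) (M Q G : 'M[R]_d)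
    (A : 'M[R]_d) : 'M[R]_d :=
  A *m M + M^T *m A + 2 *: (A *m Q^T *m Q *m A) + G.

(* The defining relation of a matrix Q_tilde always has a solution. *)
Lemma Q_tilde_exists (R : realType) (d : nat) (gamma : R) (Q : 'M[R]_d)
    (rho : 'cV[R]_d) : 0 < gamma < 1 ->
  exists Qt : 'M[R]_d, Qt^T *m Qt =
    Q^T *m Q + (gamma / (1 - gamma)) *: (Q^T *m rho *m rho^T *m Q).
Proof.
move=> /andP[g0 g1].
have c0 : 0 <= gamma / (1 - gamma) by rewrite divr_ge0 ?subr_ge0 ?ltW.
move: (gamma / (1 - gamma)) c0 => c c0.
pose b := (rho^T *m rho) 0 0.
have b0 : 0 <= b.
  by rewrite /b mxE sumr_ge0 // => i _; rewrite mxE -expr2 sqr_ge0.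
pose s := Num.sqrt (1 + c * b).
have s0 : 0 <= s by exact: sqrtr_ge0.
have s2 : s ^+ 2 = 1 + c * b.
  by rewrite sqr_sqrtr // addr_ge0 // mulr_ge0.
pose a := c / (s + 1).
have aE : a + a + a * a * b = c.
  have sn0 : s + 1 != 0 by rewrite gt_eqF // ltr_wpDl.
  have H : c * b = s ^+ 2 - 1 by rewrite s2 addrAC subrr add0r.
  have -> : a + a + a * a * b = c * (2 * (s + 1) + c * b) / (s + 1) ^+ 2.
    by rewrite /a; field.
  by rewrite H; field.
exists ((1%:M + a *: (rho *m rho^T)) *m Q).
set P := 1%:M + _.
have PT : P^T = P by rewrite /P linearD /= trmx1 linearZ /= trmx_mul trmxK.
rewrite trmx_mul PT -[LHS]mulmxA (mulmxA P).
have rr : rho *m rho^T *m (rho *m rho^T) = b *: (rho *m rho^T).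
  rewrite mulmxA -(mulmxA rho) [rho^T *m rho]mx11_scalar -/b.
  by rewrite mul_mx_scalar -scalemxAl.
have -> : P *m P = 1%:M + c *: (rho *m rho^T).
  rewrite {1}/P mulmxDl mul1mx {2}/P mulmxDr mulmx1 -scalemxAl -scalemxAr rr.
  rewrite /P !scalerA -addrA -!scalerDl.
  by congr (_ + _ *: _); rewrite -[RHS]aE; ring.
by rewrite mulmxDl mul1mx mulmxDr -scalemxAl -scalemxAr !mulmxA.
Qed.

(* Main.v *)
Require Import Defs.
From HB Require Import structures.
From mathcomp Require Import all_boot all_order all_algebra.
From mathcomp Require Import ring lra.
From mathcomp Require Import all_classical all_reals all_analysis measurable_realfun.

(* Convolution against a kernel [K] in [L^2_loc] is controlled by Cauchy-Schwarz:
   if [|G|^2 <= a b] then [|int G K|^2 <= C (int a) (int b |K|^2)].  With the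
   scalar kernel [|K|^2], which is in [L^1_loc], every estimate becomes a linear
   convolution inequality [u <= c + (|K|^2 * u)], solved by an exponential
   weight [e^(- lam t)] that makes the [L^1] norm of the weighted kernel small.
   This is used three times: for the convergence of the Picard iteration when
   the nonlinearity is truncated (replace [f] by [f o clip N]); for uniqueness
   among [L^2] solutions; and for the a priori bound saying that any truncated
   solution agreeing with an [L^2] solution on [0, T] stays below a constant
   independent of [N].  Gluing the truncated solutions up to the times at which
   they reach their truncation level gives the maximal solution; by the a priori
   bound an [L^2] solution on [0, T] forces some level to be never reached on
   [0, T], hence, by continuity, T < Tmax. *)

Set Implicit Arguments.
Unset Strict Implicit.
Unset Printing Implicit Defensive.

Import Order.TTheory GRing.Theory Num.Theory.
Import numFieldNormedType.Exports.

Local Open Scope classical_set_scope.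
Local Open Scope ring_scope.

(** The obstacle is that an [L^2] competitor may be unbounded. The local Lipschitz constant of the
    quadratic [f] along two solutions [x] and [y] is then a function of time, of order
    [1 + |x| + |y|], and itself only in [L^2]. Squaring before estimating repairs this:
    Cauchy-Schwarz integrates the square of that function by itself, which gives a finite number,
    and leaves the squared difference of the solutions to be convolved with [|K|^2]. This is why
    squared norms are used throughout.

    Blow-up of the norm at a finite Tmax comes from the same fact as the bound T < Tmax in
    uniqueness: an [L^2] solution on [0, T] forces T < Tmax. If [psi] had finite norm on [0, Tmax],
    it would be such a solution, and Tmax < Tmax would follow. At the time Tmax itself nothing is
    known about [psi], so it matters that this fact assumes the equation only almost everywhere. *)

Section integral_tools.
Context {R : realType}.
Local Notation mu := (@lebesgue_measure R).

(** * Null sets, invariance of Lebesgue measure, and integral inequalities *)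

Lemma ae_sub (P Q : R -> Prop) : (forall x, P x -> Q x) ->
  {ae mu, forall x, P x} -> {ae mu, forall x, Q x}.
Proof.
move=> PQ [N [mN N0 sN]]; exists N; split => // x nQ; apply: sN => Px.
exact/nQ/PQ.
Qed.

Lemma ae_and (P Q : R -> Prop) : {ae mu, forall x, P x} ->
  {ae mu, forall x, Q x} -> {ae mu, forall x, P x /\ Q x}.
Proof.
move=> [N [mN N0 sN]] [N' [mN' N'0 sN']]; exists (N `|` N'); split.
- exact: measurableU.
- by rewrite null_set_setU.
- move=> x /= nPQ; apply: contrapT => /not_orP[nN nN']; apply: nPQ; split.
    by apply: contrapT => nP; exact/nN/sN.
  by apply: contrapT => nP; exact/nN'/sN'.
Qed.

Lemma measurable_reflect (t : R) :
  @measurable_fun _ _ (measurableTypeR R) (measurableTypeR R) setT (fun s : R => t - s).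
Proof.
by apply: (@measurable_funB _ (measurableTypeR R)); [exact: measurable_cst|exact: measurable_id].
Qed.

Lemma lebesgue_measure_reflect (t : R) (A : set R) : measurable A ->
  pushforward mu ((fun s => t - s) : _ -> measurableTypeR R) A = mu A.
Proof.
move=> mA; apply/esym.
pose f : {mfun measurableTypeR R >-> measurableTypeR R} :=
  HB.pack ((fun s => t - s) : measurableTypeR R -> measurableTypeR R)
   (isMeasurableFun.Build _ _ _ _ _ (measurable_reflect t)).
apply: (@lebesgue_measure_unique R (pushforward mu f)) => //= _ [[a b]] _ <-.
rewrite /pushforward.
have -> : (f @^-1` [set` `]a, b]]) = [set` `[t - b, t - a[].
  by apply/seteqP; split => x /=; rewrite !in_itv/= => /andP[? ?]; apply/andP; split; lra.
rewrite !lebesgue_measure_itv/= !lte_fin.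
have -> : (t - b < t - a) = (a < b) by apply/idP/idP; lra.
case: ifP => // _; rewrite -EFinB; congr (_%:E); ring.
Qed.

Lemma ge0_integral_reflect (t : R) (g : R -> \bar R) :
  measurable_fun [set: R] g -> (forall x, (0 <= g x)%E) ->
  (\int[mu]_s g (t - s)%R = \int[mu]_s g s)%E.
Proof.
move=> mg g0.
have := @ge0_integral_pushforward _ _ (measurableTypeR R) (measurableTypeR R) R
  (fun s => t - s) (measurable_reflect t) mu setT g measurableT mg (fun x _ => g0 x).
rewrite preimage_setT => <-.
apply: eq_measure_integral => [|? A mA _]; 
  [exact: measurable_reflect|exact: lebesgue_measure_reflect].
Qed.

Lemma ge0_integral_translate (s : R) (g : R -> \bar R) :
  measurable_fun [set: R] g -> (forall x, (0 <= g x)%E) ->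
  (\int[mu]_t g (t - s)%R = \int[mu]_t g t)%E.
Proof.
move=> mg g0.
rewrite -[RHS](ge0_integral_reflect 0)//.
rewrite -[RHS](ge0_integral_reflect s)//.
- by apply: eq_integral => t _; congr g; ring.
- by apply: measurableT_comp => //; exact: measurable_reflect.
Qed.

(** Integrating in [t] and exchanging the integrals by Tonelli factors the convolution into a
    product of two integrals, so the integral of [U] is at most half of itself. Being finite, it
    vanishes. *)
Lemma convolution_contraction_eq0 (U kap : R -> R) :
  measurable_fun [set: R] U -> measurable_fun [set: R] kap ->
  (forall x, 0 <= U x) -> (forall x, 0 <= kap x) ->
  (\int[mu]_s (kap s)%:E <= 2^-1%:E)%E -> (\int[mu]_t (U t)%:E < +oo)%E ->
  {ae mu, forall t, ((U t)%:E <= \int[mu]_s (U (t - s)%R * kap s)%:E)%E} ->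
  (\int[mu]_t (U t)%:E = 0)%E.
Proof.
move=> mU mk U0 k0 kle Uoo Uae.
pose F (z : R * R) : \bar R := (U (z.1 - z.2) * kap z.2)%:E.
have F0 z : (0 <= F z)%E by rewrite lee_fin mulr_ge0.
have mF : measurable_fun [set: R * R] F.
  apply/measurable_EFinP; apply: measurable_funM.
    apply: measurableT_comp => //.
    by apply: measurable_funB; [exact: measurable_fst|exact: measurable_snd].
  by apply: measurableT_comp => //; exact: measurable_snd.
have I0 : (0 <= \int[mu]_t (U t)%:E)%E.
  by apply: integral_ge0 => x _; rewrite lee_fin.
have H : (\int[mu]_t (U t)%:E <= (\int[mu]_s (kap s)%:E) * \int[mu]_t (U t)%:E)%E.
  have -> : ((\int[mu]_s (kap s)%:E) * \int[mu]_t (U t)%:E =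
      \int[mu]_t \int[mu]_s (F (t, s)))%E.
    have -> := @fubini_tonelli _ _ (measurableTypeR R) (measurableTypeR R) R
      mu mu F mF F0.
    rewrite -ge0_integralZr//; last 2 first.
    - exact/measurable_EFinP.
    - by move=> x _; rewrite lee_fin.
    apply: eq_integral => s _.
    rewrite /F/=.
    under [RHS]eq_integral do rewrite mulrC EFinM.
    rewrite ge0_integralZl//; do ?[by rewrite lee_fin|
      by move=> x _; rewrite lee_fin]; last first.
      apply/measurable_EFinP; apply: measurableT_comp => //.
      by apply: measurable_funB; [exact: measurable_id|exact: measurable_cst].
    congr (_ * _)%E.
    rewrite (@ge0_integral_translate s (fun x => (U x)%:E))//.
    exact/measurable_EFinP.
  apply: ae_ge0_le_integral => //.
  - by move=> x _; rewrite lee_fin.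
  - exact/measurable_EFinP.
  - by move=> x _; apply: integral_ge0.
  - exact: (@measurable_fun_fubini_tonelli_F _ _ (measurableTypeR R) (measurableTypeR R)).
  - by apply: ae_sub Uae => t + _.
have {H} : (\int[mu]_t (U t)%:E <= 2^-1%:E * \int[mu]_t (U t)%:E)%E.
  by apply: (le_trans H); exact: lee_wpmul2r.
have : (\int[mu]_t (U t)%:E)%E \is a fin_num by rewrite ge0_fin_numE.
move: I0; move: (\int[mu]_t (U t)%:E)%E => [r| |]//.
rewrite lee_fin => r0 _; rewrite -EFinM lee_fin => H.
by congr (_%:E); lra.
Qed.

Lemma measurable_expRN_linear (D : set R) (lam : R) :
  measurable_fun D (fun s : R => expR (- (lam * s))).
Proof.
apply: measurableT_comp => //.
rewrite (_ : (fun _ => _) = (fun x => (- lam) * x)); last first.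
  by apply/funext => x; rewrite mulNr.
by apply: measurable_funTS; exact: mulrl_measurable.
Qed.

(** Dominated convergence along integer weights, with [k] as envelope: the weighted kernel tends to
    0 except at [s = 0], where the weight stays 1, and that point is null. *)
Lemma weighted_integral_small (k : R -> R) (T eps : R) : 0 < eps ->
  measurable_fun `[0, T] k -> (forall x, 0 <= k x) ->
  (\int[mu]_(s in `[0%R, T]) (k s)%:E < +oo)%E ->
  exists2 lam : R, 0 <= lam &
    (\int[mu]_(s in `[0%R, T]) (expR (- (lam * s)) * k s)%:E <= eps%:E)%E.
Proof.
move=> e0 mk k0 koo.
have ik : mu.-integrable `[0, T] (EFin \o k).
  apply/integrableP; split; first exact/measurable_EFinP.
  by under eq_integral do rewrite /= ger0_norm//.
pose f n (s : R) : \bar R := (expR (- (n%:R * s)) * k s)%:E.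
have mexp (c : R) : measurable_fun `[0, T] (fun s : R => expR (- (c * s))).
  exact: measurable_expRN_linear.
have := @dominated_convergence _ _ _ mu `[0, T] _ f (cst 0%E) (EFin \o k).
case => //.
- by move=> n; apply/measurable_EFinP; apply: measurable_funM => //; exact: mexp.
- exists [set 0%R]; split; [exact: measurable_set1|exact: lebesgue_measure_set1|].
  move=> x /= nH; apply: contrapT => /eqP x0; apply: nH.
  rewrite in_itv/= => /andP[xge0 _].
  have {x0 xge0} x0 : 0 < x by rewrite lt_neqAle eq_sym x0.
  rewrite /f; apply/cvg_EFin; first exact: nearW.
  rewrite -[X in _ --> X](mul0r (k x)).
  apply: cvgMl.
  have -> : (fun n : nat => expR (- (n%:R * x))) = (fun n => expR (- x) ^+ n).
    by apply/funext => n; rewrite -expRM_natl mulrN.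
  by apply: cvg_expr; rewrite ger0_norm ?expR_ge0// expR_lt1; lra.
- apply: nearW => x n /=; rewrite in_itv/= => /andP[x0 _].
  rewrite lee_fin ger0_norm ?mulr_ge0 ?expR_ge0// ler_piMl//.
  by rewrite -expR0 ler_expR oppr_le0 mulr_ge0.
move=> _ _; rewrite integral0 => fcvg.
have : \forall n \near \oo, (\int[mu]_(x in `[0%R, T]) f n x < eps%:E)%E.
  apply: (fcvg [set x | (x < eps%:E)%E]); exists eps => //= r /=.
  rewrite sub0r normrN lte_fin.
  exact/le_lt_trans/ler_norm.
move=> [N _ /(_ N (leqnn N))] /= H.
by exists N%:R => //; exact: ltW.
Qed.

(** This is Hoelder for the square roots of [a] and [b]. Keeping the right-hand side in the extended
    reals lets the estimate be stated before either integral is known to be finite. *)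
Lemma cauchy_schwarz_Rintegral d (X : measurableType d)
    (nu : {measure set X -> \bar R}) (D : set X) (G a b : X -> R) :
  measurable D -> measurable_fun D G -> measurable_fun D a ->
  measurable_fun D b -> (forall x, D x -> 0 <= a x) ->
  (forall x, D x -> 0 <= b x) -> (forall x, D x -> G x ^+ 2 <= a x * b x) ->
  (((\int[nu]_(x in D) G x) ^+ 2)%:E <=
    (\int[nu]_(x in D) (a x)%:E) * \int[nu]_(x in D) (b x)%:E)%E.
Proof.
move=> mD mG ma mb a0 b0 Gab.
pose ra := (fun x => Num.sqrt (a x)) \_ D.
pose rb := (fun x => Num.sqrt (b x)) \_ D.
have msq (c : X -> R) : measurable_fun D c ->
    measurable_fun [set: X] ((fun x => Num.sqrt (c x)) \_ D).
  move=> mc; apply/(measurable_restrictT _ mD).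
  apply: measurableT_comp => //; apply: continuous_measurable_fun.
  exact: sqrt_continuous.
have nrm (c : X -> R) : measurable_fun D c -> (forall x, D x -> 0 <= c x) ->
   ('N[nu]_2%:E[EFin \o ((fun x => Num.sqrt (c x)) \_ D)] `^ 2 =
    \int[nu]_(x in D) (c x)%:E)%E.
  move=> mc c0; rewrite poweR_Lnorm//.
  rewrite [RHS]integral_mkcond; apply: eq_integral => x _.
  rewrite /= /patch; case: ifPn => xD; last first.
    by rewrite (_ : point = 0 :> R)// normr0 powR0.
  rewrite powR_mulrn ?normr_ge0// ger0_norm ?sqrtr_ge0//.
  by rewrite sqr_sqrtr// c0// -in_setE.
rewrite -(nrm a)// -(nrm b)// -/ra -/rb.
have H : ('N[nu]_1[EFin \o (ra \* rb)%R] <=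
    'N[nu]_2%:E[EFin \o ra] * 'N[nu]_2%:E[EFin \o rb])%E.
  by apply: hoelder => //; [exact: msq|exact: msq|lra].
have H1 : (`|\int[nu]_(x in D) G x|%:E <= 'N[nu]_1[EFin \o (ra \* rb)%R])%E.
  apply: (@le_trans _ _ `|\int[nu]_(x in D) (G x)%:E|%E).
    (* [Rintegral] takes the value 0 when the integral is infinite, so the comparison holds in that
       case too. *)
    by rewrite /Rintegral; case: (integral _ _ _) => [r| |]//=; rewrite normr0 leey.
  have mGE : measurable_fun D (fun x => (G x)%:E) by exact/measurable_EFinP.
  apply: (le_trans (le_abse_integral nu mD mGE)).
  rewrite Lnorm1 [leLHS]integral_mkcond; apply: ge0_le_integral => //.
  - by move=> x _; rewrite /patch; case: ifP.
  - apply/(measurable_restrictT _ mD); apply: measurableT_comp => //.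
  - apply: measurableT_comp => //; apply/measurable_EFinP.
    by apply: measurable_funM; exact: msq.
  - move=> x _; rewrite /patch/= /ra /rb /patch; case: ifPn => xD; last first.
      by rewrite mul0r normr0.
    have Dx : D x by rewrite -in_setE.
    rewrite lee_fin -sqrtrM ?a0// [leRHS]ger0_norm ?sqrtr_ge0//.
    by rewrite -sqrtr_sqr ler_wsqrtr// Gab.
rewrite -poweRM ?Lnorm_ge0//.
rewrite -real_normK ?num_real// -powR_mulrn// -poweR_EFin.
apply: gt0_ler_poweR => //.
- by rewrite in_itv/= lee_fin normr_ge0 leey.
- by rewrite in_itv/= mule_ge0 ?Lnorm_ge0// leey.
- exact: le_trans H1 H.
Qed.
End integral_tools.

(** * The squared Frobenius norm *)

Section square_norm.
Context {R : realType} {d : nat}.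
Implicit Types A B P : 'M[R]_d.

Definition sqn A : R := \sum_i \sum_j A i j ^+ 2.

Lemma sqn_ge0 A : 0 <= sqn A.
Proof. by apply: sumr_ge0 => i _; apply: sumr_ge0 => j _; exact: sqr_ge0. Qed.

Lemma sqn0 : sqn 0 = 0.
Proof. by rewrite /sqn !big1// => i _; rewrite big1// => j _; rewrite mxE expr0n. Qed.

Lemma sqr_entry_le_sqn A i j : A i j ^+ 2 <= sqn A.
Proof.
rewrite /sqn (bigD1 i)//= (bigD1 j)//= -addrA lerDl addr_ge0//.
  by apply: sumr_ge0 => *; exact: sqr_ge0.
by apply: sumr_ge0 => i' _; apply: sumr_ge0 => *; exact: sqr_ge0.
Qed.

Lemma le_sqn A B : (forall i j, A i j ^+ 2 <= B i j ^+ 2) -> sqn A <= sqn B.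
Proof. by move=> AB; apply: ler_sum => i _; apply: ler_sum. Qed.

Lemma sqn_le_cst A (c : R) : (forall i j, A i j ^+ 2 <= c) ->
  sqn A <= d%:R ^+ 2 * c.
Proof.
move=> Ac; apply: (@le_trans _ _ (\sum_(i < d) \sum_(j < d) c)).
  by apply: ler_sum => i _; apply: ler_sum.
by rewrite !sumr_const !card_ord -mulrnA -natrX mulr_natl.
Qed.

Lemma frobenius_sqr A : frobenius A ^+ 2 = sqn A.
Proof. by rewrite /frobenius sqr_sqrtr// sqn_ge0. Qed.

Lemma entry_le_frobenius A i j : `|A i j| <= frobenius A.
Proof. by rewrite -sqrtr_sqr ler_wsqrtr// sqr_entry_le_sqn. Qed.

Lemma sqnD A B : sqn (A + B) <= 2 * (sqn A + sqn B).
Proof.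
rewrite /sqn -big_split/= mulr_sumr; apply: ler_sum => i _.
rewrite -big_split/= mulr_sumr; apply: ler_sum => j _.
rewrite mxE; have := sqr_ge0 (A i j - B i j); nra.
Qed.

Lemma sqnZ (c : R) A : sqn (c *: A) = c ^+ 2 * sqn A.
Proof.
rewrite /sqn mulr_sumr; apply: eq_bigr => i _; rewrite mulr_sumr.
by apply: eq_bigr => j _; rewrite mxE exprMn.
Qed.

(** The constant is crude: an entry of the product is a sum of [d] terms, each at most the product
    of the norms, and there are [d^2] entries to square and add. *)
Lemma sqnM A B : sqn (A *m B) <= d%:R ^+ 4 * (sqn A * sqn B).
Proof.
rewrite (_ : _ * _ = d%:R ^+ 2 * (d%:R ^+ 2 * (sqn A * sqn B))); last by ring.
apply: sqn_le_cst => i j.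
rewrite mxE -!frobenius_sqr -!exprMn -[leLHS]real_normK ?num_real//.
have f0 A' : 0 <= frobenius A' by exact: sqrtr_ge0.
rewrite ler_sqr ?nnegrE ?mulr_ge0//.
apply: (le_trans (ler_norm_sum _ _ _)).
apply: (@le_trans _ _ (\sum_(k < d) (frobenius A * frobenius B))).
  apply: ler_sum => k _; rewrite normrM.
  by apply: ler_pM => //; exact: entry_le_frobenius.
by rewrite sumr_const card_ord mulr_natl.
Qed.

(** The squared form of a Lipschitz bound whose constant grows linearly. It is the only property of
    the Riccati map on which existence and uniqueness rest. *)
Definition quadratic_lipschitz (C : R) (f : 'M[R]_d -> 'M[R]_d) :=
  forall A B, sqn (f A - f B) <= C * (1 + sqn A + sqn B) * sqn (A - B).

Lemma riccati_quadratic_lipschitz M Q G :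
  exists2 C, 0 <= C & quadratic_lipschitz C (riccati M Q G).
Proof.
pose P := Q^T *m Q; pose D : R := d%:R ^+ 4.
have D0 : 0 <= D by exact: exprn_ge0.
exists (4 * D * sqn M + 4 * D * sqn M^T + 32 * D ^+ 2 * sqn P).
  by rewrite !addr_ge0 ?mulr_ge0 ?sqn_ge0// exprn_ge0.
move=> A B.
(* The quadratic part telescopes: [A P A - B P B = (A - B) P A + B P (A - B)]. *)
have -> : riccati M Q G A - riccati M Q G B =
   ((A - B) *m M + M^T *m (A - B)) + 2 *: ((A - B) *m P *m A + B *m P *m (A - B)).
  rewrite /riccati /P !mulmxBl !mulmxBr !mulmxA.
  have -> : A *m Q^T *m Q *m A - B *m Q^T *m Q *m A +
    (B *m Q^T *m Q *m A - B *m Q^T *m Q *m B) =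
    A *m Q^T *m Q *m A - B *m Q^T *m Q *m B by rewrite addrA subrK.
  by apply/matrixP => i j; rewrite !mxE; ring.
set H := A - B.
have P1 := sqnM H M; have P2 := sqnM M^T H.
have P3 := sqnM (H *m P) A; have P4 := sqnM (B *m P) H.
have P5 := sqnM H P; have P6 := sqnM B P.
have S1 := sqnD (H *m M + M^T *m H) (2 *: (H *m P *m A + B *m P *m H)).
have S2 := sqnD (H *m M) (M^T *m H).
have S3 := sqnD (H *m P *m A) (B *m P *m H).
rewrite sqnZ in S1; rewrite -/D in P1 P2 P3 P4 P5 P6.
have [[[h0 a0] b0] p0] := (sqn_ge0 H, sqn_ge0 A, sqn_ge0 B, sqn_ge0 P).
have [m0 n0] := (sqn_ge0 M, sqn_ge0 M^T).
have {}P3 : sqn (H *m P *m A) <= D * (D * (sqn H * sqn P) * sqn A).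
  by apply: (le_trans P3); rewrite ler_wpM2l// ler_wpM2r.
have {}P4 : sqn (B *m P *m H) <= D * (D * (sqn B * sqn P) * sqn H).
  by apply: (le_trans P4); rewrite ler_wpM2l// ler_wpM2r.
(* [E] is exactly the gap between the claimed bound and the sum of the estimates above, so only
   linear arithmetic remains. *)
have E : 0 <= 4 * D * (sqn M + sqn M^T) * sqn H * (sqn A + sqn B) +
    16 * D ^+ 2 * sqn P * sqn H * (2 + sqn A + sqn B).
  by rewrite addr_ge0// !mulr_ge0 ?exprn_ge0 ?addr_ge0.
lra.
Qed.

Lemma quadratic_lipschitz_growth (C : R) f : 0 <= C -> quadratic_lipschitz C f ->
  exists2 C', 0 <= C' & forall A, sqn (f A) <= C' * (1 + sqn A) ^+ 2.
Proof.
move=> C0 fC; exists (2 * C + 2 * sqn (f 0)).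
  by rewrite addr_ge0 ?mulr_ge0 ?sqn_ge0.
move=> A; have := sqnD (f A - f 0) (f 0); rewrite subrK => H.
have := fC A 0; rewrite sqn0 addr0 subr0 => HA.
have E : 0 <= C * (1 + sqn A) + sqn (f 0) * (sqn A * (2 + sqn A)).
  by rewrite addr_ge0 ?mulr_ge0 ?addr_ge0 ?mulr_ge0 ?sqn_ge0// addr_ge0 ?sqn_ge0.
lra.
Qed.

(** Projection onto a cube instead of a ball: it is still bounded, nonexpansive and the identity
    where [sqn A <= N ^+ 2], and each property can be checked entry by entry. *)
Definition clip (N : R) A : 'M[R]_d :=
  \matrix_(i, j) Num.max (- N) (Num.min N (A i j)).

Lemma sqn_clip_bound N A : 0 <= N -> sqn (clip N A) <= d%:R ^+ 2 * N ^+ 2.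
Proof.
move=> N0; apply: sqn_le_cst => i j; rewrite mxE.
by case: (leP N (A i j)) => ?; case: (leP (- N) _) => ?; nra.
Qed.

Lemma sqn_clipB N A B : 0 <= N -> sqn (clip N A - clip N B) <= sqn (A - B).
Proof.
move=> N0; apply: le_sqn => i j; rewrite !mxE.
rewrite -[leLHS]real_normK ?num_real// -[leRHS]real_normK ?num_real//.
rewrite ler_sqr ?nnegrE//.
by case: (leP N (A i j)) => ?; case: (leP (- N) _) => ?;
  case: (leP N (B i j)) => ?; case: (leP (- N) _) => ?;
  rewrite ler_norml; case: (ler0P (A i j - B i j)) => ?; apply/andP; split; lra.
Qed.

Lemma clip_id N A : 0 <= N -> sqn A <= N ^+ 2 -> clip N A = A.
Proof.
move=> N0 AN; apply/matrixP => i j; rewrite mxE.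
have := le_trans (sqr_entry_le_sqn A i j) AN.
rewrite -[leLHS]real_normK ?num_real// ler_sqr ?nnegrE// ler_norml => /andP[l u].
by rewrite min_r// max_r.
Qed.
End square_norm.

(** * Continuity of convolutions *)

Section scalar_convolution.
Context {R : realType}.
Local Notation mu := (@lebesgue_measure R).

Lemma sqr_integrable (T : R) (h : R -> R) : measurable_fun `[0, T] h ->
  (\int[mu]_(s in `[0%R, T]) (h s ^+ 2)%:E < +oo)%E ->
  mu.-integrable `[0, T] (EFin \o h).
Proof.
move=> mh hoo.
have mh2 : measurable_fun `[0, T] (fun s => h s ^+ 2) by exact: measurable_funX.
have i1 : mu.-integrable `[0, T] (EFin \o (cst 1 : R -> R)).
  by apply: measurable_bounded_integrable => //;
    [rewrite /= lebesgue_measure_itv/= ; case: ifP => //; rewrite ?ltry|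
     exists 1; split => // x x1 y _ /=; rewrite normr1 ltW].
have i2 : mu.-integrable `[0, T] (EFin \o (fun s => h s ^+ 2)).
  apply/integrableP; split; first exact/measurable_EFinP.
  by under eq_integral do rewrite /= ger0_norm ?sqr_ge0//.
apply: (le_integrable _ _ _ (integrableD _ i1 i2)) => //.
  exact/measurable_EFinP.
move=> s _ /=; rewrite lee_fin [leRHS]ger0_norm ?addr_ge0 ?sqr_ge0//.
by rewrite -[X in _ + X]real_normK ?num_real//; have := normr_ge0 (h s); nra.
Qed.

Lemma integrable_bounded_mul (D : set R) (p h : R -> R) (B : R) :
  measurable D -> measurable_fun D p -> (forall s, D s -> `|p s| <= B) ->
  mu.-integrable D (EFin \o h) -> mu.-integrable D (EFin \o (fun s => p s * h s)).
Proof.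
move=> mD mp pB ih.
have mh : measurable_fun D h by apply/measurable_EFinP; exact: measurable_int ih.
apply: (@le_integrable _ _ _ mu D mD _ (fun s => B%:E * (h s)%:E)%E) => //; last first.
- exact: integrableZl.
- move=> s Ds /=; rewrite lee_fin !normrM ler_wpM2r//.
  by rewrite (le_trans (pB s Ds))// ler_norm.
- by apply/measurable_EFinP; exact: measurable_funM.
Qed.

Lemma measurable_reflect_comp (D : set R) (p : R -> R) (t : R) :
  measurable_fun [set: R] p -> measurable_fun D (fun s => p (t - s)).
Proof.
move=> mp; apply: measurable_funTS; apply: measurableT_comp => //.
exact: measurable_reflect.
Qed.

Variables (kap : R -> R).
Hypotheses (mkap : measurable_fun [set: R] kap) (kap0 : forall s, s < 0 -> kap s = 0).
Hypothesis kap2 : forall T, (\int[mu]_(s in `[0%R, T]) (kap s ^+ 2)%:E < +oo)%E.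

Lemma kernel_integrable T : mu.-integrable `[0, T] (EFin \o kap).
Proof. by apply: sqr_integrable => //; exact: measurable_funTS. Qed.

(** A symmetric interval has 0 in its interior, so continuity of the primitive inside the interval
    also gives continuity at [t = 0]. *)
Lemma kernel_integrable_sym T : mu.-integrable `[- T, T] (EFin \o kap).
Proof.
apply/integrable_mkcond => //.
rewrite (_ : _ \_ _ = (EFin \o kap) \_ `[0, T]).
  have /integrable_mkcond := kernel_integrable T; exact.
apply/funext => x; rewrite /patch/= !mem_setE !in_itv/=.
have [x0|x0] := ltP x 0; last by congr (if _ then _ else _); lra.
by rewrite kap0//=; case: ifP.
Qed.

Lemma continuous_kernel_primitive :
  continuous (fun t : R => \int[mu]_(s in `[0, t]) kap s).
Proof.
move=> t; pose T := `|t| + 1.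
have T0 : - T < T by rewrite /T; have := normr_ge0 t; lra.
have H := parameterized_integral_continuous (ltW T0) (kernel_integrable_sym T).
apply: (@within_continuous_continuous _ _ _ (- T) T) => //; last first.
  by rewrite in_itv/= /T; have := ler_norm t; have := ler_norm (- t); rewrite normrN; lra.
rewrite (_ : (fun _ => _) = parameterized_integral mu (- T) ^~ kap)//.
apply/funext => x; rewrite /parameterized_integral.
rewrite Rintegral_mkcond [RHS]Rintegral_mkcond; congr Rintegral.
apply/funext => y; rewrite /patch/= !mem_setE !in_itv/=.
have [y0|y0] := ltP y 0; first by rewrite kap0//=; case: ifP.
by congr (if _ then _ else _); rewrite /T; have := normr_ge0 t; lra.
Qed.

(** The variable [t] occurs both in the integrand and as the upper limit. Writing [p = q + p 0]
    separates the two: [q] vanishes on the nonpositive axis, so its integral may run over a fixed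
    interval and dominated convergence applies, while the constant part gives the primitive of the
    kernel. *)
Lemma continuous_convolution (p : R -> R) (B : R) : continuous p ->
  (forall x, `|p x| <= B) -> (forall x, x <= 0 -> p x = p 0) ->
  continuous (fun t : R => \int[mu]_(s in `[0, t]) (p (t - s) * kap s)).
Proof.
move=> cp pB p0.
have mp : measurable_fun [set: R] p by exact: continuous_measurable_fun.
pose q x := p x - p 0.
have cq : continuous q by move=> x; apply: continuousB; [exact: cp|exact: cvg_cst].
have mq : measurable_fun [set: R] q by exact: continuous_measurable_fun.
have qB x : `|q x| <= B + B by rewrite (le_trans (ler_normB _ _))// lerD.
have q0 x : x <= 0 -> q x = 0 by move=> x0; rewrite /q p0// subrr.
move=> t; pose T := `|t| + 1.
have tT : t < T by rewrite /T; have := ler_norm t; lra.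
have iq x : mu.-integrable `[0, T] (EFin \o (fun s => q (x - s) * kap s)).
  apply: (integrable_bounded_mul (B := B + B)) => //.
  - exact: measurable_reflect_comp.
  - exact: kernel_integrable.
have E : {near t, (fun x => \int[mu]_(s in `[0, T]) (q (x - s) * kap s) +
    p 0 * \int[mu]_(s in `[0, x]) kap s) =1
    (fun t => \int[mu]_(s in `[0, t]) (p (t - s) * kap s))}.
  near=> x.
  have xT : x < T by near: x; exact: lt_nbhsl.
  rewrite -RintegralZl//; last exact: kernel_integrable.
  have -> : \int[mu]_(s in `[0, T]) (q (x - s) * kap s) =
      \int[mu]_(s in `[0, x]) (q (x - s) * kap s).
    rewrite Rintegral_mkcond [RHS]Rintegral_mkcond; congr Rintegral.
    apply/funext => s; rewrite /patch/= !mem_setE !in_itv/=.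
    have [sx|sx] := leP s x; last by rewrite q0 ?mul0r ?if_same//; lra.
    by congr (if _ then _ else _); lra.
  rewrite -RintegralD//.
  - by apply: eq_Rintegral => s _; rewrite /q; ring.
  - apply: (integrableS _ _ _ (iq x)) => //.
    by apply: subset_itvl; rewrite bnd_simp ltW.
  - exact: (integrableZl _ _ (kernel_integrable x)).
have C : {for t, continuous (fun x : R =>
    \int[mu]_(s in `[0, T]) (q (x - s) * kap s) +
    p 0 * \int[mu]_(s in `[0, x]) kap s)}.
  apply: continuousD; last first.
    by apply: continuousM; [exact: cvg_cst|exact: continuous_kernel_primitive].
  have := @continuity_under_integral R _ _ mu (fun x s => q (x - s) * kap s)
    `[0, T]%classic (measurable_itv _) (- T) T (fun x _ => iq x) _
    (fun s => (B + B) * `|kap s|).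
  move=> /(_ _ _ _ t); apply.
  - apply: nearW => s _ x _.
    apply: (@cvgM _ _ _ _ (fun x : R => q (x - s)) (fun=> kap s)); last exact: cvg_cst.
    apply: (@continuous_comp _ _ _ (fun x => x - s) q); last exact: cq.
    by apply: continuousB; [exact: cvg_id|exact: cvg_cst].
  - have ik : mu.-integrable `[0, T] (EFin \o (fun s => `|kap s|)).
      exact: integrable_norm (kernel_integrable T).
    exact: (integrableZl _ (B + B) ik).
  - move=> x _; apply: nearW => s _; rewrite normrM ler_wpM2r//.
  - rewrite mem_setE in_itv/= tT andbT /T.
    by have := ler_norm (- t); rewrite normrN; lra.
have Et := nbhs_singleton E.
rewrite /continuous_at -Et; apply: cvg_trans C; exact: near_eq_cvg.
Unshelve. all: by end_near.
Qed.
End scalar_convolution.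

(** * Limits of sequences and of matrix-valued maps *)

Lemma lim_geometric_increments (R : realType) (u : nat -> R) (c : R) :
  (forall n, `|u n.+1 - u n| <= c * 2^-1 ^+ n) ->
  u @ \oo --> limn u /\ forall n, `|limn u - u n| <= 2 * c * 2^-1 ^+ n.
Proof.
move=> uc.
have c0 : 0 <= c by have := le_trans (normr_ge0 _) (uc 0); rewrite expr0 mulr1.
have g0 n : 0 <= (2^-1 : R) ^+ n by apply: exprn_ge0; rewrite invr_ge0.
(* [e n] is the tail of the geometric series, so [u - e] increases and [u + e] decreases. Monotone
   convergence gives the limit, and its position between the two sequences gives the rate. *)
pose e n := 2 * c * 2^-1 ^+ n.
have eS n : e n.+1 = e n - c * 2^-1 ^+ n by rewrite /e exprS; field.
have ecvg : e n @[n --> \oo] --> (0 : R).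
  rewrite -[X in _ --> X](mulr0 (2 * c)); apply: cvgMr.
  by apply: cvg_expr; rewrite ger0_norm; lra.
have vnd : nondecreasing_seq (fun n => u n - e n).
  apply/nondecreasing_seqP => n; rewrite eS.
  by have := uc n; rewrite ler_norml => /andP[l _]; lra.
have wni : nonincreasing_seq (fun n => u n + e n).
  apply/nonincreasing_seqP => n; rewrite eS.
  by have := uc n; rewrite ler_norml => /andP[_ l]; lra.
have e0 n : 0 <= e n by rewrite !mulr_ge0.
have vc : cvgn (fun n => u n - e n).
  apply: nondecreasing_is_cvgn => //; exists (u 0 + e 0) => _ [n _ <-].
  by have := wni 0 n (leq0n _); have := e0 n; lra.
have ucvg : cvgn u.
  rewrite (_ : u = (fun n => (u n - e n) + e n)); last by apply/funext => n; ring.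
  by apply: is_cvgD => //; apply/cvg_ex; exists 0.
have lv : limn (fun n => u n - e n) = limn u.
  by apply/cvg_lim => //; rewrite -[X in _ --> X]subr0; apply: cvgB.
have lw : limn (fun n => u n + e n) = limn u.
  by apply/cvg_lim => //; rewrite -[X in _ --> X]addr0; apply: cvgD.
have wc : cvgn (fun n => u n + e n).
  by apply: is_cvgD => //; apply/cvg_ex; exists 0.
split => // n.
have := nondecreasing_cvgn_le vnd vc n; rewrite lv => h1.
have := nonincreasing_cvgn_ge wni wc n; rewrite lw => h2.
by rewrite ler_norml -/(e n); apply/andP; split; lra.
Qed.

Lemma continuous_of_uniform_approx (R : realType) (p : R -> R) (u : nat -> R -> R) :
  (forall n, continuous (u n)) ->
  (forall T, exists c : R, forall n t, t <= T -> `|p t - u n t| <= c * 2^-1 ^+ n) ->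
  continuous p.
Proof.
move=> cu up t; have [c H] := up (t + 1).
apply/cvgrPdist_le => /= eps e0.
have : (c * 2^-1 ^+ n) @[n --> \oo] --> (0 : R).
  rewrite -[X in _ --> X](mulr0 c); apply: cvgMr.
  by apply: cvg_expr; rewrite ger0_norm; lra.
move/cvgrPdist_le => /(_ (eps / 3)) [|N _ /(_ N (leqnn N))]; first lra.
rewrite /= sub0r normrN => HN.
have := cu N t => /cvgrPdist_le /(_ (eps / 3)) => C.
near=> x.
have xT : x <= t + 1 by apply: ltW; near: x; apply: lt_nbhsl; lra.
have Ct : `|u N t - u N x| <= eps / 3 by near: x; apply: C; lra.
have h1 := le_trans (H N t _) (le_trans (ler_norm _) HN).
have h2 := le_trans (H N x xT) (le_trans (ler_norm _) HN).
have {}h1 : `|p t - u N t| <= eps / 3 by apply: h1; lra.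
rewrite (_ : p t - p x = (p t - u N t) + (u N t - u N x) - (p x - u N x)); last by ring.
by apply: (le_trans (ler_normB _ _)); have := ler_normD (p t - u N t) (u N t - u N x); lra.
Unshelve. all: by end_near.
Qed.

Section entrywise_convergence.
Context {R : realType} {d : nat} {T : Type} {F : set_system T} {FF : ProperFilter F}.
Variables (u : T -> 'M[R]_d) (A : 'M[R]_d).
Hypothesis uA : forall i j, u x i j @[x --> F] --> A i j.

Lemma cvg_sqn : sqn (u x) @[x --> F] --> sqn A.
Proof.
rewrite /sqn.
have csum (I : Type) (r : seq I) (f : I -> T -> R) (a : I -> R) :
    (forall i, f i x @[x --> F] --> a i) ->
    (\sum_(i <- r) f i x) @[x --> F] --> \sum_(i <- r) a i.
  move=> fa; elim: r => [|i r IH].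
    by rewrite big_nil; under eq_fun do rewrite big_nil; exact: cvg_cst.
  rewrite big_cons; under eq_fun do rewrite big_cons; exact: cvgD.
apply: (csum) => i; apply: (csum) => j; rewrite expr2; under eq_fun do rewrite expr2.
exact: cvgM.
Qed.
End entrywise_convergence.

Lemma cvg_lipschitz_entry (R : realType) (d : nat) (T : Type) (F : set_system T)
    (FF : ProperFilter F) (L : R) (g : 'M[R]_d -> 'M[R]_d) (u : T -> 'M[R]_d) (A : 'M[R]_d) :
  (forall A B, sqn (g A - g B) <= L * sqn (A - B)) ->
  (forall i j, u x i j @[x --> F] --> A i j) ->
  forall i j, g (u x) i j @[x --> F] --> g A i j.
Proof.
move=> gL uA i j.
have S0 : L * sqn (u x - A) @[x --> F] --> (0 : R).
  rewrite -[X in _ --> X](mulr0 L); apply: cvgMr; rewrite -(@sqn0 R d).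
  apply: cvg_sqn => i' j'; rewrite mxE -(subrr (A i' j')).
  under eq_fun do rewrite !mxE.
  by apply: cvgB => //; exact: cvg_cst.
have S : Num.sqrt (L * sqn (u x - A)) @[x --> F] --> (0 : R).
  rewrite -[X in _ --> X](@sqrtr0 R).
  exact: (cvg_comp _ _ S0 (@sqrt_continuous R 0)).
apply/subr_cvg0; apply: norm_cvg0.
apply: (squeeze_cvgr _ (cvg_cst 0) S).
apply: nearW => x; rewrite normr_ge0/=.
rewrite -sqrtr_sqr ler_wsqrtr//; apply: le_trans (gL _ _).
by have := sqr_entry_le_sqn (g (u x) - g A) i j; rewrite !mxE.
Qed.

Lemma continuous_sqn (R : realType) (d : nat) (psi : R -> 'M[R]_d) :
  (forall i j, continuous (fun t => psi t i j)) ->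
  continuous (fun t => sqn (psi t)).
Proof. by move=> cpsi t; apply: (@cvg_sqn R d R (nbhs t)) => i j; exact: cpsi. Qed.

Lemma continuous_entryB (R : realType) (d : nat) (psi phi : R -> 'M[R]_d) :
  (forall i j, continuous (fun t => psi t i j)) ->
  (forall i j, continuous (fun t => phi t i j)) ->
  forall i j, continuous (fun t => (psi t - phi t) i j).
Proof.
move=> cpsi cphi i j t.
rewrite (_ : (fun _ => _) = (fun t => psi t i j - phi t i j)); last first.
  by apply/funext => x; rewrite !mxE.
by apply: cvgB; [exact: cpsi|exact: cphi].
Qed.

(** * Volterra equations with a Lipschitz nonlinearity *)

Section volterra.
Context {R : realType} {d : nat}.
Local Notation mu := (@lebesgue_measure R).
Variable K : 'I_d -> R -> R.
Hypotheses (mK : forall j, measurable_fun [set: R] (K j)).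
Hypotheses (K_neg : forall j s, s < 0 -> K j s = 0).
Hypotheses (K_L2 : forall j T,
  (\int[mu]_(s in `[0%R, T]) (K j s ^+ 2)%:E < +oo)%E).

Definition kernel_sqr s := \sum_j K j s ^+ 2.

Lemma measurable_kernel_sqr : measurable_fun [set: R] kernel_sqr.
Proof. by apply: measurable_sum => j; exact: measurable_funX. Qed.

Lemma kernel_sqr_ge0 s : 0 <= kernel_sqr s.
Proof. by apply: sumr_ge0 => j _; exact: sqr_ge0. Qed.

Lemma kernel_le_sqr j s : K j s ^+ 2 <= kernel_sqr s.
Proof.
by rewrite /kernel_sqr (bigD1 j)//= lerDl; apply: sumr_ge0 => *; exact: sqr_ge0.
Qed.

Lemma kernel_sqr_integral T :
  (\int[mu]_(s in `[0%R, T]) (kernel_sqr s)%:E < +oo)%E.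
Proof.
rewrite /kernel_sqr; under eq_integral do rewrite -sumEFin.
rewrite ge0_integral_sum//=; last 2 first.
- move=> j; apply/measurable_EFinP; apply: measurable_funX.
  by apply: measurable_funTS; exact: mK.
- by move=> j x _; rewrite lee_fin sqr_ge0.
by apply: lte_sum_pinfty => j _; exact: K_L2.
Qed.

Definition kernel_mx (s : R) : 'M[R]_d := diag_mx (\row_i K i s).

Lemma kernel_mxE (A : 'M[R]_d) s i j : (A *m kernel_mx s) i j = A i j * K j s.
Proof. by rewrite mul_mx_diag !mxE. Qed.

Definition convolution (F : R -> 'M[R]_d) (t : R) : 'M[R]_d :=
  \matrix_(i, j) \int[mu]_(s in `[0, t]) (F (t - s) i j * K j s).

Lemma volterra_atE f psi t : volterra_at f kernel_mx psi t <->
  (forall i j, mu.-integrable `[0, t]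
     (EFin \o (fun s => f (psi (t - s)) i j * K j s))) /\
  psi t = convolution (f \o psi) t.
Proof.
have E1 i j : (fun s => ((f (psi (t - s)) *m kernel_mx s) i j)%:E) =
   EFin \o (fun s => f (psi (t - s)) i j * K j s).
  by apply/funext => s; rewrite kernel_mxE.
have E2 : convolution (f \o psi) t = \matrix_(i, j)
    (\int[mu]_(s in `[0, t]) ((f (psi (t - s)) *m kernel_mx s) i j)).
  apply/matrixP => i j; rewrite !mxE; apply: eq_Rintegral => s _.
  by rewrite kernel_mxE.
rewrite /volterra_at -E2; split=> -[H ->]; split => // i j.
  by rewrite -E1.
by rewrite E1.
Qed.

Lemma convolution_le0 F t : t <= 0 -> convolution F t = 0.
Proof.
rewrite le_eqVlt => /predU1P[->|t0]; apply/matrixP => i j; rewrite !mxE.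
  by rewrite set_itv1 Rintegral_set1.
by rewrite set_itv_ge ?Rintegral_set0// bnd_simp -ltNge.
Qed.

(** The number of entries, with 1 added so that the constant can be inverted for every [d]. *)
Definition mxcst : R := 1 + d%:R ^+ 2.

Lemma mxcst_gt0 : 0 < mxcst.
Proof. by rewrite /mxcst ltr_wpDr// exprn_ge0. Qed.

(** The estimate shared by all three applications. The factor [a], integrated alone, is what is
    already controlled: a constant for the Picard iteration, the Lipschitz weight for uniqueness, a
    growth factor for the a priori bound. The factor [b] carries the unknown. *)
Lemma sqn_convolution_le (t : R) (X : 'M[R]_d) (G : R -> 'M[R]_d)
    (a b : R -> R) (alpha : R) :
  (forall i j, X i j = \int[mu]_(s in `[0, t]) (G s i j * K j s)) ->
  (forall i j, measurable_fun `[0, t] (fun s => G s i j * K j s)) ->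
  measurable_fun `[0, t] a -> measurable_fun `[0, t] b ->
  (forall s, s \in `[0, t] -> 0 <= a s) ->
  (forall s, s \in `[0, t] -> 0 <= b s) ->
  (forall s, s \in `[0, t] -> sqn (G s) <= a s * b s) ->
  (\int[mu]_(s in `[0%R, t]) (a s)%:E <= alpha%:E)%E ->
  ((sqn X)%:E <= (mxcst * alpha)%:E *
     \int[mu]_(s in `[0%R, t]) (b s * kernel_sqr s)%:E)%E.
Proof.
move=> XE mG ma mb a0 b0 Gab aalpha.
set P := (\int[mu]_(s in `[0%R, t]) (b s * kernel_sqr s)%:E)%E.
have P0 : (0 <= P)%E.
  by apply: integral_ge0 => s st; rewrite lee_fin mulr_ge0 ?b0 ?kernel_sqr_ge0.
have al0 : 0 <= alpha.
  rewrite -lee_fin; apply: le_trans aalpha.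
  by apply: integral_ge0 => s st; rewrite lee_fin a0.
have mk : measurable_fun `[0, t] kernel_sqr.
  by apply: measurable_funTS; exact: measurable_kernel_sqr.
have H i j : (((X i j) ^+ 2)%:E <= alpha%:E * P)%E.
  rewrite XE.
  apply: (le_trans (cauchy_schwarz_Rintegral (a := a)
     (b := fun s => b s * kernel_sqr s) mu _ _ _ _ _ _ _)) => //.
  - exact: mG.
  - exact: measurable_funM.
  - by move=> s st; rewrite mulr_ge0 ?b0 ?kernel_sqr_ge0.
  - move=> s st; rewrite exprMn mulrA ler_pM ?sqr_ge0 ?kernel_le_sqr//.
    by apply: le_trans (Gab s st); exact: sqr_entry_le_sqn.
  - exact: lee_wpmul2r.
move: P0 H; move: P => [p| |]// p0 H.
- rewrite -EFinM lee_fin /mxcst.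
  have := @sqn_le_cst _ _ X (alpha * p) (fun i j => H i j).
  have : 0 <= alpha * p by rewrite mulr_ge0.
  lra.
(* For [alpha = 0] the right-hand side is [0 * +oo = 0], and the claim is that [X] vanishes.
   Uniqueness at a given time uses this degenerate case. *)
- have [al|al] := eqVneq alpha 0; last first.
    by rewrite gt0_muley ?leey// lte_fin mulr_gt0 ?mxcst_gt0// lt_neqAle eq_sym al.
  rewrite al in H *; rewrite mulr0 mul0e lee_fin.
  apply: (le_trans (sqn_le_cst (c := 0) _)); last by rewrite mulr0.
  by move=> i j; have := H i j; rewrite mul0e lee_fin.
Qed.

Lemma weighted_kernel_small (T alpha : R) : 0 < alpha -> exists2 lam : R, 0 <= lam &
  (\int[mu]_(s in `[0%R, T]) (expR (- (lam * s)) * kernel_sqr s)%:E <= alpha%:E)%E.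
Proof.
move=> a0; apply: weighted_integral_small => //.
- by apply: measurable_funTS; exact: measurable_kernel_sqr.
- exact: kernel_sqr_ge0.
- exact: kernel_sqr_integral.
Qed.

(* The weight [e^(lam t)] turns convolution with the kernel into a contraction. *)
Lemma weighted_convolution_le (T lam alpha c t : R) (b : R -> R) : 0 <= c -> t <= T ->
  (\int[mu]_(s in `[0%R, T]) (expR (- (lam * s)) * kernel_sqr s)%:E <= alpha%:E)%E ->
  measurable_fun `[0, t] b -> (forall s, s \in `[0, t] -> 0 <= b s) ->
  (forall s, s \in `[0, t] -> b s <= c * expR (lam * (t - s))) ->
  (\int[mu]_(s in `[0%R, t]) (b s * kernel_sqr s)%:E <=
    (c * expR (lam * t) * alpha)%:E)%E.
Proof.
move=> c0 tT aalpha mb b0 bc.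
have mk D : measurable_fun D kernel_sqr.
  by apply: measurable_funTS; exact: measurable_kernel_sqr.
have me D : measurable_fun D (fun s : R => expR (- (lam * s))).
  exact: measurable_expRN_linear.
apply: (@le_trans _ _ (\int[mu]_(s in `[0%R, t])
   ((c * expR (lam * t))%:E * (expR (- (lam * s)) * kernel_sqr s)%:E))%E).
  apply: ge0_le_integral => //.
  - by move=> s st; rewrite lee_fin mulr_ge0 ?b0 ?kernel_sqr_ge0.
  - by apply/measurable_EFinP; exact: measurable_funM mb (mk _).
  - by apply: measurable_funeM; apply/measurable_EFinP; exact: measurable_funM (me _) (mk _).
  - move=> s st; rewrite -EFinM lee_fin mulrA ler_wpM2r ?kernel_sqr_ge0//.
    by rewrite -mulrA -expRD (le_trans (bc s st))// mulrBr.
rewrite ge0_integralZl//.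
- rewrite [leRHS]EFinM lee_wpmul2l ?lee_fin ?mulr_ge0 ?expR_ge0//.
  apply: le_trans aalpha; apply: ge0_subset_integral => //.
  - by apply/measurable_EFinP; exact: measurable_funM (me _) (mk _).
  - by move=> s st; rewrite lee_fin mulr_ge0 ?expR_ge0 ?kernel_sqr_ge0.
  - by apply: subset_itvl; rewrite bnd_simp.
- by apply/measurable_EFinP; exact: measurable_funM (me _) (mk _).
- by move=> s st; rewrite lee_fin mulr_ge0 ?expR_ge0 ?kernel_sqr_ge0.
- by rewrite lee_fin mulr_ge0 ?expR_ge0.
Qed.

(** * Picard iteration for a bounded Lipschitz nonlinearity *)

Section picard_iteration.
Variables (g : 'M[R]_d -> 'M[R]_d) (L B : R).
Hypothesis L_ge0 : 0 <= L.
Hypothesis g_lipschitz : forall A A', sqn (g A - g A') <= L * sqn (A - A').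
Hypothesis g_bounded : forall A, sqn (g A) <= B.

Lemma bounded_entry A i j : `|g A i j| <= Num.sqrt B.
Proof.
rewrite -sqrtr_sqr ler_wsqrtr//; apply: le_trans (g_bounded A).
exact: sqr_entry_le_sqn.
Qed.

Lemma continuous_lipschitz_entry (psi : R -> 'M[R]_d) :
  (forall i j, continuous (fun t => psi t i j)) ->
  forall i j, continuous (fun t => g (psi t) i j).
Proof.
by move=> cpsi i j t; apply: (@cvg_lipschitz_entry R d _ (nbhs t) _ L) => // i' j'; exact: cpsi.
Qed.

Lemma convolution_integrable (psi : R -> 'M[R]_d) t :
  (forall i j, continuous (fun t => psi t i j)) ->
  forall i j, mu.-integrable `[0, t]
     (EFin \o (fun s => g (psi (t - s)) i j * K j s)).
Proof.
move=> cpsi i j; apply: (integrable_bounded_mul (B := Num.sqrt B)) => //.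
- apply: (@measurable_reflect_comp _ _ (fun s => g (psi s) i j)).
  by apply: continuous_measurable_fun; exact: continuous_lipschitz_entry.
- by move=> s _; exact: bounded_entry.
- by apply: kernel_integrable => //; exact: mK.
Qed.

Fixpoint picard (n : nat) : R -> 'M[R]_d :=
  if n is m.+1 then convolution (g \o picard m) else fun=> 0.

Lemma picard_le0 n t : t <= 0 -> picard n t = 0.
Proof. by case: n => [//|n] t0; exact: convolution_le0. Qed.

Lemma picard_continuous n i j : continuous (fun t => picard n t i j).
Proof.
elim: n i j => [|n IH] i j.
  by move=> t; rewrite (_ : (fun _ => _) = cst 0);
    [exact: cvg_cst|apply/funext => x; rewrite mxE].
rewrite (_ : (fun _ => _) =
    (fun t => \int[mu]_(s in `[0, t]) (g (picard n (t - s)) i j * K j s))); last first.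
  by apply/funext => t; rewrite mxE.
apply: (@continuous_convolution _ (K j) _ _ _ (fun t => g (picard n t) i j) (Num.sqrt B)).
- exact: mK.
- exact: K_neg.
- exact: K_L2.
- exact: continuous_lipschitz_entry.
- by move=> x; exact: bounded_entry.
- by move=> x x0; rewrite !picard_le0.
Qed.

Lemma convolution_sub (psi phi : R -> 'M[R]_d) t :
  (forall i j, continuous (fun t => psi t i j)) ->
  (forall i j, continuous (fun t => phi t i j)) ->
  forall i j, (convolution (g \o psi) t - convolution (g \o phi) t) i j =
  \int[mu]_(s in `[0, t]) ((g (psi (t - s)) - g (phi (t - s))) i j * K j s).
Proof.
move=> cpsi cphi i j; rewrite !mxE -RintegralB//; last 2 first.
- exact: convolution_integrable.
- exact: convolution_integrable.
by apply: eq_Rintegral => s _; rewrite !mxE mulrBl.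
Qed.

(** In the supremum norm weighted by [e^(- lam t)] each iteration divides the squared increment by
    4, hence the increment by 2. On times up to [T] the weight only costs a constant. *)
Lemma picard_increment (T : R) : exists2 c : R, 0 <= c &
  forall n t, t <= T -> sqn (picard n.+1 t - picard n t) <= c * 4^-1 ^+ n.
Proof.
(* Bounds the integral of the constant [L] over any [0, t] with [t <= T]; the added 1 keeps it
   invertible, and the maximum with 0 admits a negative [T]. *)
pose alpha := L * Num.max T 0 + 1.
have M0 : 0 <= Num.max T 0 by rewrite le_max lexx orbT.
have al0 : 0 < alpha by rewrite ltr_wpDl// mulr_ge0.
(* The weighted kernel is made small enough to absorb the factor [mxcst * alpha] of
   [sqn_convolution_le] and still leave 1/4. *)
have Dal : 0 < 4 * (mxcst * alpha) by rewrite !mulr_gt0// mxcst_gt0.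
have [|lam lam0 Hlam] := @weighted_kernel_small T (4 * (mxcst * alpha))^-1.
  by rewrite invr_gt0.
have B0 : 0 <= B by apply: le_trans (g_bounded 0); exact: sqn_ge0.
pose I := (\int[mu]_(s in `[0%R, T]) (kernel_sqr s)%:E)%E.
have I0 : (0 <= I)%E.
  by apply: integral_ge0 => s _; rewrite lee_fin kernel_sqr_ge0.
have Ifin : I \is a fin_num by rewrite ge0_fin_numE// kernel_sqr_integral.
(* Size of the first increment, the convolution of the constant [g 0]: [sqn_convolution_le] with
   [a = B] and [b = 1]. *)
pose c0 := mxcst * (B * Num.max T 0) * fine I.
have c00 : 0 <= c0 by rewrite !mulr_ge0 ?fine_ge0// ltW// mxcst_gt0.
have cstint (x t : R) : 0 <= t -> t <= T -> 0 <= x ->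
    (\int[mu]_(s in `[0%R, t]) x%:E <= (x * Num.max T 0)%:E)%E.
  move=> t0 tT x0; rewrite integral_cst//= lebesgue_measure_itv/= lte_fin.
  rewrite EFinM; apply: lee_wpmul2l; first by rewrite lee_fin.
  case: ifPn => _; last by rewrite lee_fin.
  by rewrite sube0 lee_fin le_max tT.
have mk D : measurable_fun D kernel_sqr.
  by apply: measurable_funTS; exact: measurable_kernel_sqr.
have main n t : 0 <= t -> t <= T ->
    sqn (picard n.+1 t - picard n t) <= c0 * 4^-1 ^+ n * expR (lam * t).
  elim: n t => [|n IH] t t0 tT.
    rewrite expr0 mulr1 subr0; apply: (@le_trans _ _ c0); last first.
      by rewrite ler_peMr// -expR0 ler_expR mulr_ge0.
    rewrite -lee_fin.
    apply: (le_trans (@sqn_convolution_le t _ (fun s => g (picard 0 (t - s)))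
      (cst B) (cst 1) (B * Num.max T 0) _ _ _ _ _ _ _ _)) => //.
    - by move=> i j; rewrite mxE.
    - move=> i j; exact: measurable_funM (measurable_cst (g 0 i j)) (measurable_funTS (mK j)).
    - by move=> s _ /=; rewrite mulr1.
    - exact: cstint.
    rewrite /c0 [leRHS]EFinM lee_wpmul2l ?lee_fin ?mulr_ge0 ?(ltW mxcst_gt0)// fineK//.
    under eq_integral do rewrite /= mul1r.
    apply: ge0_subset_integral => //.
    - by apply/measurable_EFinP; exact: mk.
    - by move=> s _; rewrite lee_fin kernel_sqr_ge0.
    - by apply: subset_itvl; rewrite bnd_simp.
  pose u s := sqn (picard n.+1 (t - s) - picard n (t - s)).
  have mu_ : measurable_fun `[0, t] u.
    apply: (@measurable_reflect_comp _ _ (fun s => sqn (picard n.+1 s - picard n s))).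
    apply: continuous_measurable_fun; apply: continuous_sqn.
    by apply: continuous_entryB; exact: picard_continuous.
  rewrite -lee_fin.
  apply: (le_trans (@sqn_convolution_le t _
    (fun s => g (picard n.+1 (t - s)) - g (picard n (t - s)))
    (cst L) u alpha _ _ _ _ _ _ _ _)) => //.
  - move=> i j; apply: (@convolution_sub (picard n.+1) (picard n));
    exact: picard_continuous.
  - move=> i j; apply: measurable_funM; last exact: measurable_funTS (mK j).
    apply: (@measurable_reflect_comp _ _
      (fun s => (g (picard n.+1 s) - g (picard n s)) i j)).
    apply: continuous_measurable_fun; apply: continuous_entryB;
    apply: continuous_lipschitz_entry; exact: picard_continuous.
  - by move=> s _; exact: sqn_ge0.
  - apply: (le_trans (cstint _ _ t0 tT L_ge0)).
    by rewrite lee_fin /alpha lerDl.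
  have := @weighted_convolution_le T lam _ (c0 * 4^-1 ^+ n) t u _ tT Hlam mu_ _ _.
  move=> H; apply: (@le_trans _ _ ((mxcst * alpha)%:E *
     (c0 * 4^-1 ^+ n * expR (lam * t) * (4 * (mxcst * alpha))^-1)%:E)%E).
    apply: lee_wpmul2l; first by rewrite lee_fin mulr_ge0// ltW// mxcst_gt0.
    apply: H.
    - by rewrite mulr_ge0// exprn_ge0// invr_ge0.
    - by move=> s _; exact: sqn_ge0.
    - by move=> s /[!in_itv]/= /andP[s0 st]; apply: IH; lra.
  rewrite -EFinM lee_fin exprS le_eqVlt; apply/orP; left; apply/eqP.
  have xn0 : mxcst * alpha != 0 by rewrite mulf_neq0// gt_eqF// mxcst_gt0.
  by move: (mxcst * alpha) xn0 => x xn0; field.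
exists (c0 * expR (lam * Num.max T 0)); first by rewrite mulr_ge0 ?expR_ge0.
move=> n t tT; have [t0|t0] := leP t 0.
  rewrite !picard_le0// subrr sqn0 mulr_ge0 ?exprn_ge0 ?invr_ge0//.
  by rewrite mulr_ge0 ?expR_ge0.
apply: (le_trans (main n t (ltW t0) tT)).
rewrite mulrAC ler_wpM2r ?exprn_ge0 ?invr_ge0// ler_wpM2l// ler_expR.
by rewrite ler_wpM2l// le_max tT.
Qed.

(** The iterates converge uniformly to the left of every [T], so the limit is continuous. The
    equation passes to the limit by dominated convergence, with the bound on [g] times [|K j|] as
    envelope. *)
Theorem lipschitz_volterra_solution : exists psi : R -> 'M[R]_d,
  [/\ forall i j, continuous (fun t => psi t i j),
      forall t, t <= 0 -> psi t = 0 &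
      forall t, psi t = convolution (g \o psi) t].
Proof.
pose psi t : 'M[R]_d := \matrix_(i, j) limn (fun n => picard n t i j).
have inc T : exists c : R, forall i j n t, t <= T ->
    `|picard n.+1 t i j - picard n t i j| <= c * 2^-1 ^+ n.
  have [c c0 Hc] := picard_increment T; exists (Num.sqrt c) => i j n t tT.
  rewrite -ler_sqr ?nnegrE ?mulr_ge0 ?sqrtr_ge0 ?exprn_ge0 ?invr_ge0//.
  rewrite real_normK ?num_real// exprMn sqr_sqrtr// -exprM mulnC exprM.
  rewrite (_ : 2^-1 ^+ 2 = 4^-1 :> R); last by rewrite exprVn -natrX.
  apply: le_trans (Hc n t tT).
  by have := sqr_entry_le_sqn (picard n.+1 t - picard n t) i j; rewrite !mxE.
have pcvg i j t : picard n t i j @[n --> \oo] --> psi t i j.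
  have [c Hc] := inc t; rewrite mxE.
  by have [] := @lim_geometric_increments R (fun n => picard n t i j) c
    (fun n => Hc i j n t (lexx t)).
have punif i j T : exists c : R, forall n t, t <= T ->
    `|psi t i j - picard n t i j| <= c * 2^-1 ^+ n.
  have [c Hc] := inc T; exists (2 * c) => n t tT; rewrite mxE.
  by have [_] := @lim_geometric_increments R (fun n => picard n t i j) c
    (fun n => Hc i j n t tT); apply.
have cpsi i j : continuous (fun t => psi t i j).
  apply: (@continuous_of_uniform_approx R _ (fun n t => picard n t i j)).
    by move=> n; exact: picard_continuous.
  exact: punif.
exists psi; split => //.
  move=> t t0; apply/matrixP => i j; rewrite !mxE.
  under eq_fun do rewrite picard_le0// mxE.
  exact: lim_cst.
move=> t; apply/matrixP => i j.
have C1 : picard n.+1 t i j @[n --> \oo] --> psi t i j.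
  by rewrite (cvg_shiftS (fun n => picard n t i j)).
have C2 : picard n.+1 t i j @[n --> \oo] --> convolution (g \o psi) t i j.
  rewrite mxE; under eq_fun do rewrite mxE.
  have := @dominated_convergence _ _ _ mu `[0, t]%classic (measurable_itv _)
    (fun n s => (g (picard n (t - s)) i j * K j s)%:E)
    (fun s => (g (psi (t - s)) i j * K j s)%:E)
    (fun s => (Num.sqrt B)%:E * `|(K j s)%:E|)%E.
  case.
  - move=> n.
    by have /integrableP[+ _] := convolution_integrable t (@picard_continuous n) i j.
  - by have /integrableP[+ _] := convolution_integrable t cpsi i j.
  - apply: nearW => s _; apply/cvg_EFin; first exact: nearW.
    apply: cvgMl; apply: (@cvg_lipschitz_entry R d nat \oo _ L g (fun n => picard n (t - s))
      (psi (t - s))); first exact: g_lipschitz.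
    by move=> i' j'; exact: pcvg.
  - apply: integrableZl => //; apply: integrable_abse.
    by apply: kernel_integrable => //; exact: mK.
  - apply: nearW => s n _; rewrite lee_fin normrM ler_wpM2r//.
    exact: bounded_entry.
  move=> ipsi _.
  have fin : (\int[mu]_(s in `[0%R, t]) (g (psi (t - s)%R) i j * K j s)%:E)%E
    \is a fin_num by exact: integrable_fin_num.
  by rewrite -(fineK fin) => /fine_cvgP[_].
exact: (cvg_unique _ C1 C2).
Qed.
End picard_iteration.
End volterra.

(** * Square-integrability expressed through integrals of [sqn] *)

Section L2.
Context {R : realType}.
Local Notation mu := (@lebesgue_measure R).

Lemma L2norm_on_lty (D : set R) (h : R -> R) :
  ((L2norm_on D h < +oo) = (\int[mu]_(t in D) (h t ^+ 2)%:E < +oo))%E.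
Proof.
have E : (L2norm_on D h `^ 2 = \int[mu]_(t in D) (h t ^+ 2)%:E)%E.
  rewrite /L2norm_on poweR_Lnorm// [RHS]integral_mkcond.
  apply: eq_integral => x _; rewrite /= /patch; case: ifPn => xD.
    by rewrite powR_mulrn// real_normK// num_real.
  by rewrite (_ : point = 0 :> R)// normr0 powR0.
rewrite -E; apply/idP/idP => [|]; first exact: poweR_lty.
exact: lty_poweRy.
Qed.

Lemma mx_in_L2E (d : nat) (D : set R) (psi : R -> 'M[R]_d) :
  mx_in_L2 D psi <-> (forall i j, measurable_fun D (fun t => psi t i j)) /\
  (\int[mu]_(t in D) (sqn (psi t))%:E < +oo)%E.
Proof.
rewrite /mx_in_L2 /mxL2norm_on L2norm_on_lty.
by under eq_integral do rewrite frobenius_sqr.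
Qed.

Lemma measurable_sqn (d : nat) (D : set R) (psi : R -> 'M[R]_d) :
  (forall i j, measurable_fun D (fun t => psi t i j)) ->
  measurable_fun D (fun t => sqn (psi t)).
Proof.
move=> mpsi; apply: measurable_sum => i; apply: measurable_sum => j.
exact: measurable_funX.
Qed.

Lemma ge0_integral_reflect_itv (t : R) (h : R -> R) : measurable_fun `[0, t] h ->
  (forall s, s \in `[0, t] -> 0 <= h s) ->
  (\int[mu]_(s in `[0%R, t]) (h (t - s)%R)%:E =
   \int[mu]_(s in `[0%R, t]) (h s)%:E)%E.
Proof.
move=> mh h0; rewrite integral_mkcond [RHS]integral_mkcond.
rewrite -[RHS](ge0_integral_reflect t).
- apply: eq_integral => s _; rewrite /patch !mem_setE !in_itv/=.
  by congr (if _ then _ else _); lra.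
- by apply/(measurable_restrictT _ (measurable_itv _)); apply/measurable_EFinP.
- move=> s; rewrite /patch mem_setE; case: ifPn => // st.
  by rewrite lee_fin h0.
Qed.

Lemma mx_in_L2_subset (d : nat) (T T' : R) (psi : R -> 'M[R]_d) : T' <= T ->
  mx_in_L2 `[0, T] psi -> mx_in_L2 `[0, T'] psi.
Proof.
move=> TT /mx_in_L2E[mpsi Ipsi]; apply/mx_in_L2E.
have sub : `[0, T'] `<=` `[0, T] by apply: subset_itvl; rewrite bnd_simp.
split; first by move=> i j; apply: measurable_funS (mpsi i j).
apply: le_lt_trans Ipsi; apply: ge0_subset_integral => //.
- by apply/measurable_EFinP; exact: measurable_sqn.
- by move=> s _; rewrite lee_fin sqn_ge0.
Qed.

Lemma integral_affine_sqn_lty (d : nat) (T c : R) (psi : R -> 'M[R]_d) : 0 <= c ->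
  mx_in_L2 `[0, T] psi ->
  (\int[mu]_(s in `[0%R, T]) (c * (1 + sqn (psi s)))%:E < +oo)%E.
Proof.
move=> c0 /mx_in_L2E[mpsi Ipsi]; have ms := measurable_sqn mpsi.
under eq_integral do rewrite EFinM.
rewrite ge0_integralZl//.
- under eq_integral do rewrite EFinD.
  rewrite ge0_integralD//.
  + apply: lte_mul_pinfty => //.
    rewrite lte_add_pinfty// integral_cst//= mul1e lebesgue_measure_itv/=.
    by case: ifP => //; rewrite ?ltry.
  + by move=> s _; rewrite lee_fin sqn_ge0.
  + exact/measurable_EFinP.
- by apply/measurable_EFinP; apply: measurable_funD.
- by move=> s _; rewrite lee_fin addr_ge0 ?sqn_ge0.
Qed.
End L2.

(** * Convolution Gronwall inequalities *)

Section gronwall.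
Context {R : realType} {d : nat}.
Local Notation mu := (@lebesgue_measure R).
Variable K : 'I_d -> R -> R.
Hypotheses (mK : forall j, measurable_fun [set: R] (K j)).
Hypotheses (K_L2 : forall j T,
  (\int[mu]_(s in `[0%R, T]) (K j s ^+ 2)%:E < +oo)%E).
Local Notation k := (kernel_sqr K).

(** Since [e^(- lam t) = e^(- lam (t - s)) e^(- lam s)], the weighted function satisfies the same
    inequality with the weighted kernel. As [u] is merely integrable, the contraction takes place in
    [L^1] and the conclusion is almost everywhere. *)
Lemma convolution_gronwall_ae (T c : R) (u : R -> R) : 0 <= c ->
  measurable_fun [set: R] u -> (forall t, 0 <= u t) ->
  (forall t, t \notin `[0, T] -> u t = 0) -> (\int[mu]_t (u t)%:E < +oo)%E ->
  {ae mu, forall t, t \in `[0, T] ->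
    ((u t)%:E <= c%:E * \int[mu]_(s in `[0%R, t]) (u (t - s)%R * k s)%:E)%E} ->
  {ae mu, forall t, u t = 0}.
Proof.
move=> c0 mu_ u0 uT uoo uae.
(* After multiplication by [c] this is at most 1/2; [c + 1] avoids dividing by 0. *)
have al0 : 0 < (2 * (c + 1))^-1 by rewrite invr_gt0; lra.
have [lam lam0 Hlam] := weighted_kernel_small mK K_L2 T al0.
have mk D : measurable_fun D k.
  by apply: measurable_funTS; exact: measurable_kernel_sqr.
have me D : measurable_fun D (fun s : R => expR (- (lam * s))).
  exact: measurable_expRN_linear.
pose U t := expR (- (lam * t)) * u t.
pose kap := (fun s => c * (expR (- (lam * s)) * k s)) \_ `[0, T].
have U0 t : 0 <= U t by rewrite mulr_ge0 ?expR_ge0.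
have kap0 t : 0 <= kap t.
  by rewrite /kap /patch; case: ifP => // _; rewrite !mulr_ge0 ?expR_ge0 ?kernel_sqr_ge0.
have mkap0 D : measurable_fun D (fun s => c * (expR (- (lam * s)) * k s)).
  apply: measurable_funM; first exact: measurable_cst.
  exact: measurable_funM (me _) (mk _).
have mkap : measurable_fun [set: R] kap.
  by apply/(measurable_restrictT _ (measurable_itv _)).
have mU : measurable_fun [set: R] U by exact: measurable_funM (me _) mu_.
have IU : (\int[mu]_t (U t)%:E = 0)%E.
  apply: (convolution_contraction_eq0 mU mkap) => //.
  - have -> : (\int[mu]_s (kap s)%:E =
        \int[mu]_(s in `[0%R, T]) (c%:E * (expR (- (lam * s)) * k s)%:E))%E.
      rewrite [RHS]integral_mkcond; apply: eq_integral => s _.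
      by rewrite /kap /patch; case: ifP => // _; rewrite EFinM.
    rewrite ge0_integralZl//.
    + apply: (@le_trans _ _ (c%:E * ((2 * (c + 1))^-1)%:E)%E).
        exact: lee_wpmul2l.
      rewrite -EFinM lee_fin ler_pdivrMr; lra.
    + by apply/measurable_EFinP; exact: measurable_funM (me _) (mk _).
    + by move=> s _; rewrite lee_fin mulr_ge0 ?expR_ge0 ?kernel_sqr_ge0.
  - apply: le_lt_trans uoo; apply: ge0_le_integral => //.
    + by move=> s _; rewrite lee_fin.
    + exact/measurable_EFinP.
    + exact/measurable_EFinP.
    + move=> s _; rewrite lee_fin /U.
      have [sT|sT] := boolP (s \in `[0, T]); last by rewrite uT// mulr0.
      rewrite ler_piMl// -expR0 ler_expR oppr_le0 mulr_ge0//.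
      by move: sT; rewrite in_itv/= => /andP[].
  - apply: ae_sub uae => t ut.
    have [tT|tT] := boolP (t \in `[0, T]); last first.
      rewrite /U uT// mulr0; apply: integral_ge0 => s _.
      by rewrite lee_fin; exact: mulr_ge0 (U0 _) (kap0 _).
    have mut D : measurable_fun D (fun s : R => u (t - s)) by exact: measurable_reflect_comp.
    have mUt D : measurable_fun D (fun s : R => U (t - s)).
      by apply: (@measurable_reflect_comp _ _ U).
    have {ut} ut := ut tT.
    apply: (@le_trans _ _ (\int[mu]_(s in `[0%R, t]) (U (t - s)%R * kap s)%:E)%E);
      last first.
      apply: ge0_subset_integral => //.
      - by apply/measurable_EFinP; exact: measurable_funM (mUt _) mkap.
      - by move=> s _; rewrite lee_fin; exact: mulr_ge0 (U0 _) (kap0 _).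
    have -> : (\int[mu]_(s in `[0%R, t]) (U (t - s)%R * kap s)%:E =
       \int[mu]_(s in `[0%R, t]) ((expR (- (lam * t)) * c)%:E * (u (t - s)%R * k s)%:E))%E.
      apply: eq_integral => s; rewrite inE/= => st.
      rewrite -EFinM /U /kap patchE mem_set/=; last first.
        by move: st tT; rewrite !in_itv/= => /andP[? ?] /andP[? ?]; apply/andP; split; lra.
      congr (_%:E).
      have -> : expR (- (lam * t)) = expR (- (lam * (t - s))) * expR (- (lam * s)).
        by rewrite -expRD; congr expR; ring.
      ring.
    rewrite ge0_integralZl//.
    + rewrite /U EFinM EFinM -muleA; apply: lee_wpmul2l; last exact: ut.
      by rewrite lee_fin expR_ge0.
    + by apply/measurable_EFinP; exact: measurable_funM (mut _) (mk _).
    + by move=> s _; rewrite lee_fin mulr_ge0 ?kernel_sqr_ge0.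
    + by rewrite lee_fin mulr_ge0 ?expR_ge0.
have : (\int[mu]_t `|(U t)%:E| = 0)%E.
  by under eq_integral do rewrite gee0_abs ?lee_fin//.
have mUE : measurable_fun [set: R] (EFin \o U) by exact/measurable_EFinP.
move=> /(ae_eq_integral_abs mu measurableT mUE).
apply: ae_sub => t /(_ I)/= [] /eqP; rewrite mulf_eq0 gt_eqF ?expR_gt0//=.
by move=> /eqP.
Qed.

(** At a maximum point [t1] of [e^(- lam s) m(s)] the inequality reads [m t1 <= 1 + m t1 / 2]. The
    bound [B] is chosen before [tau] and [m], which later makes it the same for all truncation
    levels. *)
Lemma convolution_gronwall_sup (T c : R) : 0 <= c -> exists B : R,
  forall (tau : R) (m : R -> R), tau <= T -> continuous m -> (forall t, 0 <= m t) ->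
  (forall t, t \in `[0, tau] -> ((m t)%:E <= 1%:E +
     c%:E * \int[mu]_(s in `[0%R, t]) (m (t - s)%R * k s)%:E)%E) ->
  forall t, t \in `[0, tau] -> m t <= B.
Proof.
move=> c0.
have al0 : 0 < (2 * (c + 1))^-1 by rewrite invr_gt0; lra.
have [lam lam0 Hlam] := weighted_kernel_small mK K_L2 T al0.
(* The weighted maximum is at most 2, and removing the weight costs at most [e^(lam T)]. *)
exists (2 * expR (lam * T)) => tau m tauT cm m0 mle t tt.
have tau0 : 0 <= tau by move: tt; rewrite in_itv/= => /andP[? ?]; lra.
have cwm : {within `[0, tau], continuous (fun s : R => expR (- (lam * s)) * m s)}.
  apply: continuous_subspaceT => s.
  apply: (@cvgM _ _ _ _ (fun s : R => expR (- (lam * s))) m); last exact: cm.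
  apply: (@continuous_comp _ _ _ (fun s : R => - (lam * s)) expR); last exact: continuous_expR.
  by apply: cvgN; apply: cvgMr; exact: cvg_id.
have [t1 t1tau Hmax] := EVT_max tau0 cwm.
set M := expR (- (lam * t1)) * m t1 in Hmax.
have M0 : 0 <= M by rewrite mulr_ge0 ?expR_ge0.
have mM s : s \in `[0, tau] -> m s <= M * expR (lam * s).
  by move=> /Hmax; rewrite expRN mulrC ler_pdivrMr ?expR_gt0.
have M2 : M <= 2.
  have /andP[t10 t1t] : 0 <= t1 <= tau by move: t1tau; rewrite in_itv.
  have mE : m t1 = M * expR (lam * t1).
    by rewrite /M mulrAC -expRD addNr expR0 mul1r.
  have H : (\int[mu]_(s in `[0%R, t1]) (m (t1 - s)%R * k s)%:E <=
     (M * expR (lam * t1) * (2 * (c + 1))^-1)%:E)%E.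
    apply: (weighted_convolution_le mK (T := T) (lam := lam)) => //.
    - by lra.
    - by apply: measurable_reflect_comp; exact: continuous_measurable_fun.
    - move=> s; rewrite in_itv/= => /andP[s0 st]; apply: mM; rewrite in_itv/=.
      by apply/andP; split; lra.
  have := mle _ t1tau.
  move=> /le_trans /(_ (leeD (lexx _) (lee_wpmul2l _ H))).
  rewrite -EFinM -EFinD !lee_fin => /(_ c0) {}H.
  have e1 : 1 <= expR (lam * t1) by rewrite -expR0 ler_expR mulr_ge0.
  have E : c * (M * expR (lam * t1) / (2 * (c + 1))) <= (M * expR (lam * t1)) / 2.
    have Me : 0 <= M * expR (lam * t1) by rewrite mulr_ge0 ?expR_ge0.
    move: (M * _) Me => z z0; rewrite mulrCA ler_wpM2l// ler_pdivrMr; lra.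
  have : M * expR (lam * t1) <= 2 
    by have := le_trans H (lerD (lexx 1) E); rewrite mE; lra.
  by apply: le_trans; rewrite ler_peMr.
have /andP[t0 ttau] : 0 <= t <= tau by move: tt; rewrite in_itv.
apply: (le_trans (mM t tt)); apply: ler_pM => //.
by rewrite ler_expR ler_wpM2l//; lra.
Qed.
End gronwall.

(** * Uniqueness among square-integrable solutions *)

Lemma sqnN (R : realType) (d : nat) (A : 'M[R]_d) : sqn (- A) = sqn A.
Proof. by rewrite -scaleN1r sqnZ sqrrN expr1n mul1r. Qed.

Lemma sqn_eq0 (R : realType) (d : nat) (A : 'M[R]_d) : sqn A <= 0 -> A = 0.
Proof.
move=> A0; apply/matrixP => i j; rewrite mxE; apply/eqP.
rewrite -sqrf_eq0 eq_le sqr_ge0 andbT.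
exact: le_trans (sqr_entry_le_sqn A i j) A0.
Qed.

Section uniqueness.
Context {R : realType} {d : nat}.
Local Notation mu := (@lebesgue_measure R).
Variable K : 'I_d -> R -> R.
Hypotheses (mK : forall j, measurable_fun [set: R] (K j)).
Hypotheses (K_L2 : forall j T,
  (\int[mu]_(s in `[0%R, T]) (K j s ^+ 2)%:E < +oo)%E).
Variables (f : 'M[R]_d -> 'M[R]_d) (C : R).
Hypotheses (C_ge0 : 0 <= C) (f_lipschitz : quadratic_lipschitz C f).
Local Notation k := (kernel_sqr K).

(** The factors [a] and [b] are left free because uniqueness uses the estimate twice, with their
    roles exchanged. *)
Lemma volterra_difference_le (T t alpha : R) (x y : R -> 'M[R]_d) (a b : R -> R) :
  t <= T -> volterra_at f (kernel_mx K) x t -> volterra_at f (kernel_mx K) y t ->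
  measurable_fun [set: R] a -> measurable_fun [set: R] b ->
  (forall r, 0 <= a r) -> (forall r, 0 <= b r) ->
  (forall r, r \in `[0, T] -> sqn (f (x r) - f (y r)) <= a r * b r) ->
  (\int[mu]_r (a r)%:E <= alpha%:E)%E ->
  ((sqn (x t - y t))%:E <= (mxcst (R := R) (d := d) * alpha)%:E *
     \int[mu]_(s in `[0%R, t]) (b (t - s)%R * k s)%:E)%E.
Proof.
move=> tT /volterra_atE[ix xE] /volterra_atE[iy yE] ma mb a0 b0 fab aalpha.
apply: (@sqn_convolution_le R d K mK t _ (fun s => f (x (t - s)) - f (y (t - s)))
  (fun s => a (t - s)) (fun s => b (t - s))) => //.
- move=> i j; rewrite xE yE !mxE -RintegralB//.
  by apply: eq_Rintegral => s _; rewrite !mxE mulrBl.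
- move=> i j.
  rewrite (_ : (fun _ => _) = (fun s => f (x (t - s)) i j * K j s -
      f (y (t - s)) i j * K j s)); last by apply/funext => s; rewrite !mxE mulrBl.
  have /integrableP[/measurable_EFinP mx _] := ix i j.
  have /integrableP[/measurable_EFinP my _] := iy i j.
  exact: measurable_funB.
- exact: measurable_reflect_comp.
- exact: measurable_reflect_comp.
- move=> s; rewrite in_itv/= => /andP[s0 st]; apply: fab.
  by rewrite in_itv/=; apply/andP; split; lra.
- have maE : measurable_fun [set: R] (EFin \o a) by exact/measurable_EFinP.
  rewrite ge0_integral_reflect_itv//; last by apply: measurable_funTS.
  apply: le_trans aalpha; apply: ge0_subset_integral => //.
  by move=> r _; rewrite lee_fin.
Qed.

(** Gronwall gives equality almost everywhere. At a single time where both equations hold, the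
    integrands then agree up to a null set, so the two values agree as well. *)
Lemma volterra_unique (T : R) (x y : R -> 'M[R]_d) :
  mx_in_L2 `[0, T] x -> mx_in_L2 `[0, T] y ->
  {ae mu, forall t, t \in `[0, T] -> volterra_at f (kernel_mx K) x t} ->
  {ae mu, forall t, t \in `[0, T] -> volterra_at f (kernel_mx K) y t} ->
  {ae mu, forall t, t \in `[0, T] -> x t = y t} /\
  forall t, t \in `[0, T] -> volterra_at f (kernel_mx K) x t ->
    volterra_at f (kernel_mx K) y t -> x t = y t.
Proof.
move=> xL yL xv yv.
have /mx_in_L2E[mx Ix] := xL; have /mx_in_L2E[my Iy] := yL.
have msx := measurable_sqn mx; have msy := measurable_sqn my.
pose u := (fun t => sqn (x t - y t)) \_ `[0, T].
(* With [c = C] this dominates the Lipschitz weight; with [c = 2] it dominates [sqn (x t - y t)] and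
   shows that [u] is integrable. *)
pose w0 c t := c * (1 + sqn (x t)) + c * (1 + sqn (y t)).
have mB i j : measurable_fun `[0, T] (fun t => (x t - y t) i j).
  rewrite (_ : (fun _ => _) = (fun t => x t i j - y t i j)); last first.
    by apply/funext => t; rewrite !mxE.
  exact: measurable_funB (mx i j) (my i j).
have mA c (z : R -> 'M[R]_d) : measurable_fun `[0, T] (fun t => sqn (z t)) ->
    measurable_fun `[0, T] (fun t => c * (1 + sqn (z t))).
  move=> mz; apply: measurable_funM; first exact: measurable_cst.
  by apply: measurable_funD => //; exact: measurable_cst.
have mw0 c : measurable_fun `[0, T] (w0 c).
  exact: measurable_funD (mA c x msx) (mA c y msy).
have w00 c t : 0 <= c -> 0 <= w0 c t.
  by move=> c0; rewrite addr_ge0// mulr_ge0// addr_ge0// sqn_ge0.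
have w0oo c : 0 <= c -> (\int[mu]_(t in `[0%R, T]) (w0 c t)%:E < +oo)%E.
  move=> c0; rewrite /w0; under eq_integral do rewrite EFinD.
  rewrite ge0_integralD//.
  - by apply: lte_add_pinfty; exact: integral_affine_sqn_lty.
  - by move=> t _; rewrite lee_fin mulr_ge0// addr_ge0// sqn_ge0.
  - by apply/measurable_EFinP; exact: mA.
  - by move=> t _; rewrite lee_fin mulr_ge0// addr_ge0// sqn_ge0.
  - by apply/measurable_EFinP; exact: mA.
pose w := (w0 C) \_ `[0, T].
have mu_ : measurable_fun [set: R] u.
  by apply/(measurable_restrictT _ (measurable_itv _)); exact: measurable_sqn.
have mw : measurable_fun [set: R] w.
  by apply/(measurable_restrictT _ (measurable_itv _)).
have u0 t : 0 <= u t by rewrite /u /patch; case: ifP => // _; exact: sqn_ge0.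
have w_ge0 t : 0 <= w t by rewrite /w /patch; case: ifP => // _; exact: w00.
have uT t : t \notin `[0, T] -> u t = 0.
  by move=> tT; rewrite /u patchN// mem_setE.
have uE t : t \in `[0, T] -> u t = sqn (x t - y t).
  by move=> tT; rewrite /u patchT// mem_setE.
have wE t : t \in `[0, T] -> w t = w0 C t.
  by move=> tT; rewrite /w patchT// mem_setE.
have uoo : (\int[mu]_t (u t)%:E < +oo)%E.
  have -> : (\int[mu]_t (u t)%:E = \int[mu]_(t in `[0%R, T]) (sqn (x t - y t))%:E)%E.
    rewrite [RHS]integral_mkcond; apply: eq_integral => t _.
    by rewrite /u /patch; case: ifP.
  apply: le_lt_trans (w0oo 2 _) => //; apply: ge0_le_integral => //.
  - by move=> t _; rewrite lee_fin sqn_ge0.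
  - by apply/measurable_EFinP; exact: measurable_sqn.
  - by apply/measurable_EFinP; exact: mw0.
  - move=> t _; rewrite lee_fin; apply: (le_trans (sqnD _ _)).
    rewrite sqnN /w0; lra.
pose I := (\int[mu]_t (w t)%:E)%E.
have IE : I = (\int[mu]_(t in `[0%R, T]) (w0 C t)%:E)%E.
  rewrite [RHS]integral_mkcond; apply: eq_integral => t _.
  by rewrite /w /patch; case: ifP.
have I0 : (0 <= I)%E by apply: integral_ge0 => t _; rewrite lee_fin.
have Ifin : I \is a fin_num by rewrite ge0_fin_numE// IE w0oo.
have Hf r : r \in `[0, T] -> sqn (f (x r) - f (y r)) <= w r * u r.
  move=> rT; rewrite uE// wE//; apply: (le_trans (f_lipschitz _ _)).
  rewrite ler_wpM2r ?sqn_ge0// /w0.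
  by have := C_ge0; lra.
have uae : {ae mu, forall t, u t = 0}.
  apply: (@convolution_gronwall_ae R d K mK K_L2 T
    (mxcst (R := R) (d := d) * fine I)) => //.
    by rewrite mulr_ge0 ?fine_ge0// ltW// mxcst_gt0.
  apply: ae_sub (ae_and xv yv) => t [xt yt] tT; rewrite uE//.
  apply: (@volterra_difference_le T t (fine I) x y w u) => //.
  - by move: tT; rewrite in_itv/= => /andP[].
  - exact: xt.
  - exact: yt.
  - by rewrite fineK.
split.
  apply: ae_sub uae => t ut tT; apply/eqP; rewrite -subr_eq0; apply/eqP.
  by apply: sqn_eq0; rewrite -uE// ut.
move=> t tT xt yt; apply/eqP; rewrite -subr_eq0; apply/eqP; apply: sqn_eq0.
(* Exchanged roles: [u] is now the factor integrated alone, with integral 0, which annihilates the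
   bound whatever the convolution of [w] with the kernel is at [t]. *)
have Iu : (\int[mu]_r (u r)%:E <= 0%:E)%E.
  rewrite (_ : (\int[mu]_r (u r)%:E = 0)%E)//.
  have muE : measurable_fun [set: R] (EFin \o u) by exact/measurable_EFinP.
  have : ae_eq mu [set: R] (EFin \o u) (cst 0%E).
    by apply: ae_sub uae => r /= -> _.
  move=> /(ae_eq_integral_abs mu measurableT muE) <-.
  by apply: eq_integral => r _ /=; rewrite ger0_norm.
have Hf' r : r \in `[0, T] -> sqn (f (x r) - f (y r)) <= u r * w r.
  by move=> rT; rewrite mulrC Hf.
have tT' : t <= T by move: tT; rewrite in_itv/= => /andP[].
have := volterra_difference_le tT' xt yt mu_ mw u0 w_ge0 Hf' Iu.
by rewrite mulr0 mul0e lee_fin.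
Qed.
End uniqueness.

Lemma ae_all (R : realType) (P : R -> Prop) : (forall x, P x) ->
  {ae @lebesgue_measure R, forall x, P x}.
Proof.
by move=> HP; exists set0; split => //; move=> x /= /(_ (HP x)).
Qed.

Lemma continuous_lt_near (R : realType) (g : R -> R) (a c : R) : continuous g ->
  g a < c -> exists2 e : R, 0 < e & forall s, `|a - s| < e -> g s < c.
Proof.
move=> cg gac; have /cvgrPdist_lt /(_ (c - g a)) := cg a.
rewrite subr_gt0 => /(_ gac) /nbhs_ballP[e /= e0 He]; exists e => // s /He /=.
by rewrite ltr_norml => /andP[h _]; lra.
Qed.

Lemma continuous_gt_near (R : realType) (g : R -> R) (a c : R) : continuous g ->
  c < g a -> exists2 e : R, 0 < e & forall s, `|a - s| < e -> c < g s.
Proof.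
move=> cg gac.
have [||e e0 He] := @continuous_lt_near R (fun s => - g s) a (- c).
- by move=> s; apply: cvgN; exact: cg.
- by rewrite ltrN2.
- by exists e => // s /He; rewrite ltrN2.
Qed.

(** * Truncated equations *)

Section truncation.
Context {R : realType} {d : nat}.
Local Notation mu := (@lebesgue_measure R).
Variable K : 'I_d -> R -> R.
Hypotheses (mK : forall j, measurable_fun [set: R] (K j)).
Hypotheses (K_neg : forall j s, s < 0 -> K j s = 0).
Hypotheses (K_L2 : forall j T,
  (\int[mu]_(s in `[0%R, T]) (K j s ^+ 2)%:E < +oo)%E).
Variables (f : 'M[R]_d -> 'M[R]_d) (C : R).
Hypotheses (C_ge0 : 0 <= C) (f_lipschitz : quadratic_lipschitz C f).
Local Notation k := (kernel_sqr K).

Definition truncated_solution (N : R) (psi : R -> 'M[R]_d) :=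
  [/\ forall i j, continuous (fun t => psi t i j),
      forall t, t <= 0 -> psi t = 0 &
      forall t, psi t = convolution K (f \o clip N \o psi) t].

Lemma clip_lipschitz (N : R) : 0 <= N -> exists2 L, 0 <= L &
  forall A A', sqn (f (clip N A) - f (clip N A')) <= L * sqn (A - A').
Proof.
move=> N0; exists (C * (1 + d%:R ^+ 2 * N ^+ 2 + d%:R ^+ 2 * N ^+ 2)).
  by rewrite mulr_ge0// !addr_ge0// mulr_ge0// exprn_ge0.
move=> A A'; apply: (le_trans (f_lipschitz _ _)).
apply: ler_pM.
- by rewrite mulr_ge0// !addr_ge0 ?sqn_ge0.
- exact: sqn_ge0.
- by rewrite ler_wpM2l// lerD ?lerD2l ?sqn_clip_bound.
- exact: sqn_clipB.
Qed.

Lemma clip_bounded (N : R) : 0 <= N -> exists B, forall A, sqn (f (clip N A)) <= B.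
Proof.
move=> N0; have [C' C'0 fC'] := quadratic_lipschitz_growth C_ge0 f_lipschitz.
exists (C' * (1 + d%:R ^+ 2 * N ^+ 2) ^+ 2) => A; apply: (le_trans (fC' _)).
rewrite ler_wpM2l// ler_sqr ?nnegrE ?addr_ge0 ?sqn_ge0//.
- by rewrite lerD2l sqn_clip_bound.
- by rewrite mulr_ge0// exprn_ge0.
Qed.

Lemma truncated_solution_exists (N : R) : 0 <= N ->
  exists psi, truncated_solution N psi.
Proof.
move=> N0; have [L L0 gL] := clip_lipschitz N0; have [B gB] := clip_bounded N0.
exact: (@lipschitz_volterra_solution R d K mK K_neg K_L2 (f \o clip N) L B L0 gL gB).
Qed.

Lemma truncated_solution_volterra (N : R) psi (t : R) : 0 <= N ->
  truncated_solution N psi ->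
  (forall s, s \in `[0, t] -> sqn (psi s) <= N ^+ 2) ->
  volterra_at f (kernel_mx K) psi t.
Proof.
move=> N0 [cpsi _ psiE] psiN.
have [L L0 gL] := clip_lipschitz N0; have [B gB] := clip_bounded N0.
have E s : s \in `[0, t] -> f (clip N (psi (t - s))) = f (psi (t - s)).
  rewrite in_itv/= => /andP[s0 st]; rewrite clip_id// psiN//.
  by rewrite in_itv/=; apply/andP; split; lra.
apply/volterra_atE; split.
  move=> i j.
  have := convolution_integrable mK K_L2 gL gB t cpsi i j.
  apply: eq_integrable => // s; rewrite inE/= => st.
  by rewrite E.
rewrite psiE; apply/matrixP => i j; rewrite !mxE.
by apply: eq_Rintegral => s; rewrite inE/= => st; rewrite E.
Qed.

Lemma continuous_mx_in_L2 (T : R) (psi : R -> 'M[R]_d) :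
  (forall i j, continuous (fun t => psi t i j)) -> mx_in_L2 `[0, T] psi.
Proof.
move=> cpsi; apply/mx_in_L2E; split.
  by move=> i j; apply: measurable_funTS; exact: continuous_measurable_fun.
have cs : {within `[0, T], continuous (fun t => sqn (psi t))}.
  by apply: continuous_subspaceT; exact: continuous_sqn.
have /integrableP[_] := continuous_compact_integrable (@segment_compact _ _ _) cs.
apply: le_lt_trans; rewrite le_eqVlt; apply/orP; left; apply/eqP.
by apply: eq_integral => t _ /=; rewrite ger0_norm// sqn_ge0.
Qed.

(* The bound does not depend on the truncation level: the quadratic growth is
   split as [(1 + |psi|^2) (1 + |psi|^2)], one factor being controlled in [L^1]
   by the given solution [x]. *)
Lemma truncated_solution_bound (T : R) (x : R -> 'M[R]_d) :
  mx_in_L2 `[0, T] x ->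
  {ae mu, forall t, t \in `[0, T] -> volterra_at f (kernel_mx K) x t} ->
  exists B : R, forall (N tau : R) psi, 0 <= N -> tau <= T ->
    truncated_solution N psi ->
    (forall s, s \in `[0, tau] -> sqn (psi s) <= N ^+ 2) ->
    forall t, t \in `[0, tau] -> sqn (psi t) <= B.
Proof.
move=> xL xv.
have [C' C'0 fC'] := quadratic_lipschitz_growth C_ge0 f_lipschitz.
pose I := (\int[mu]_(s in `[0%R, T]) (C' * (1 + sqn (x s)))%:E)%E.
have h0 (z : R -> 'M[R]_d) s : 0 <= C' * (1 + sqn (z s)).
  by rewrite mulr_ge0// addr_ge0// sqn_ge0.
have I0 : (0 <= I)%E by apply: integral_ge0 => s _; rewrite lee_fin.
have Ifin : I \is a fin_num by rewrite ge0_fin_numE//; exact: integral_affine_sqn_lty.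
have mh T' (z : R -> 'M[R]_d) : mx_in_L2 `[0, T'] z ->
   measurable_fun `[0, T'] (fun s => C' * (1 + sqn (z s))).
  move=> /mx_in_L2E[mz _]; apply: measurable_funM; first exact: measurable_cst.
  by apply: measurable_funD; [exact: measurable_cst|exact: measurable_sqn].
pose c := mxcst (R := R) (d := d) * fine I.
have c0 : 0 <= c by rewrite mulr_ge0 ?fine_ge0// ltW// mxcst_gt0.
have [B HB] := convolution_gronwall_sup mK K_L2 T c0.
exists B => N tau psi N0 tauT psiT psiN t tt.
have [cpsi psi0 psiE] := psiT.
have csq := continuous_sqn cpsi.
have cm : continuous (fun t => 1 + sqn (psi t)).
  by move=> s; apply: cvgD; [exact: cvg_cst|exact: csq].
have vol s : s \in `[0, tau] -> volterra_at f (kernel_mx K) psi s.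
  rewrite in_itv/= => /andP[s0 st].
  apply: (truncated_solution_volterra N0 psiT) => r; rewrite in_itv/= => /andP[r0 rs].
  by apply: psiN; rewrite in_itv/=; apply/andP; split; lra.
have ae_vol : {ae mu, forall s, s \in `[0, tau] -> volterra_at f (kernel_mx K) psi s}.
  exact: ae_all.
have ae_xv : {ae mu, forall s, s \in `[0, tau] -> volterra_at f (kernel_mx K) x s}.
  apply: ae_sub xv => s xs; rewrite in_itv/= => /andP[s0 st]; apply: xs.
  by rewrite in_itv/=; apply/andP; split; lra.
(* Below its level [psi] solves the original equation, hence equals [x] almost everywhere. Its
   growth factor therefore has an integral at most [I], in which [N] does not occur. *)
have [ae_eq_x _] := @volterra_unique R d K mK K_L2 f C C_ge0 f_lipschitz tau psi x
  (continuous_mx_in_L2 _ cpsi) (mx_in_L2_subset tauT xL) ae_vol ae_xv.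
suff : 1 + sqn (psi t) <= B by have := sqn_ge0 (psi t); lra.
apply: (HB tau (fun s => 1 + sqn (psi s))) => //.
  by move=> s; rewrite addr_ge0// sqn_ge0.
move=> s stau; have /andP[s0 st] : 0 <= s <= tau by move: stau; rewrite in_itv.
have /volterra_atE[ipsi psisE] := vol s stau.
rewrite EFinD; apply: leeD => //.
apply: (@sqn_convolution_le R d K mK s _ (fun r => f (psi (s - r)))
  (fun r => C' * (1 + sqn (psi (s - r)))) (fun r => 1 + sqn (psi (s - r)))
  (fine I)) => //.
- by move=> i j; rewrite psisE mxE.
- by move=> i j; have /integrableP[/measurable_EFinP + _] := ipsi i j.
- apply: (@measurable_reflect_comp _ _ (fun r => C' * (1 + sqn (psi r)))).
  apply: measurable_funM; first exact: measurable_cst.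
  exact: continuous_measurable_fun.
- apply: (@measurable_reflect_comp _ _ (fun r => 1 + sqn (psi r))).
  exact: continuous_measurable_fun.
- by move=> r _; rewrite addr_ge0// sqn_ge0.
- by move=> r _; rewrite -mulrA -expr2.
rewrite (@ge0_integral_reflect_itv R s (fun r => C' * (1 + sqn (psi r))))//; last first.
  by apply: mh; exact: continuous_mx_in_L2.
have sT : s <= T by lra.
rewrite fineK//; apply: (@le_trans _ _
  (\int[mu]_(r in `[0%R, s]) (C' * (1 + sqn (x r)))%:E)%E).
  rewrite le_eqVlt; apply/orP; left; apply/eqP; apply: ge0_ae_eq_integral => //.
  - by apply/measurable_EFinP; apply: mh; exact: continuous_mx_in_L2.
  - by apply/measurable_EFinP; apply: mh; exact: mx_in_L2_subset xL.
  - by move=> r _; rewrite lee_fin.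
  - by move=> r _; rewrite lee_fin.
  - apply: ae_sub ae_eq_x => r xr; rewrite /= in_itv/= => /andP[r0 rs].
    by rewrite xr// in_itv/=; apply/andP; split; lra.
apply: ge0_subset_integral => //.
- by apply/measurable_EFinP; apply: mh.
- by move=> r _; rewrite lee_fin.
- by apply: subset_itvl; rewrite bnd_simp.
Qed.

(** Consider the first time [a] at which the level is attained. Before [a] the a priori bound keeps
    [sqn psi] below [B], while at [a] it is at least [N ^+ 2 > B]; continuity from the left forbids
    this jump. *)
Lemma truncated_solution_reaches (T : R) (x : R -> 'M[R]_d) : 0 < T ->
  mx_in_L2 `[0, T] x ->
  {ae mu, forall t, t \in `[0, T] -> volterra_at f (kernel_mx K) x t} ->
  exists N0 : R, forall (N : R) psi, N0 <= N -> truncated_solution N psi ->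
    forall t, t \in `[0, T] -> sqn (psi t) < N ^+ 2.
Proof.
move=> T0 xL xv; have [B HB] := truncated_solution_bound xL xv.
(* Any [N] above this satisfies both [B < N ^+ 2] and [1 <= N]; the latter gives [a > 0], because
   [psi] vanishes at time 0. *)
pose B1 := Num.max B 0 + 1.
have B0 : 0 <= Num.max B 0 by rewrite le_max lexx orbT.
have BB : B <= Num.max B 0 by rewrite le_max lexx.
exists B1 => N psi BN psiT t tT.
have N0 : 0 <= N by rewrite (le_trans _ BN)// /B1; lra.
have BN2 : B < N ^+ 2 by rewrite /B1 in BN; nra.
have [cpsi psi0 _] := psiT.
have csq := continuous_sqn cpsi.
rewrite ltNge; apply/negP => bad.
pose A := [set s : R | 0 <= s <= T /\ N ^+ 2 <= sqn (psi s)].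
have Ane : A !=set0 by exists t; split => //; move: tT; rewrite in_itv.
have Alb : has_lbound A by exists 0 => s [/andP[]].
have Ainf : has_inf A by [].
set a := inf A.
have a0 : 0 <= a by apply: lb_le_inf => // s [/andP[]].
have aT : a <= T.
  move: tT; rewrite in_itv/= => tT'; have tA : A t by split.
  by apply: le_trans (ge_inf Alb tA) _; move: tT' => /andP[].
have lta s : 0 <= s -> s < a -> sqn (psi s) < N ^+ 2.
  move=> s0 sa; rewrite ltNge; apply/negP => H.
  have : a <= s by apply: ge_inf => //; split => //; apply/andP; split; lra.
  by rewrite leNgt sa.
have leB s : 0 <= s -> s < a -> sqn (psi s) <= B.
  move=> s0 sa; apply: (HB N s psi) => //; first by lra.
    move=> r; rewrite in_itv/= => /andP[r0 rs]; apply/ltW/lta => //; lra.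
  by rewrite in_itv/= s0 lexx.
have aB : N ^+ 2 <= sqn (psi a).
  rewrite leNgt; apply/negP => H.
  have [e e0 He] := continuous_lt_near csq H.
  have [s [s01 sN] sa] := inf_adherent e0 Ainf.
  have as_ : a <= s by apply: ge_inf.
  have : sqn (psi s) < N ^+ 2.
    by apply: He; rewrite distrC ger0_norm; rewrite -/a in sa; lra.
  by rewrite ltNge sN.
have {}a0 : 0 < a.
  rewrite lt_neqAle a0 andbT; apply/eqP => a0'.
  have N1 : 1 <= N by rewrite (le_trans _ BN)// /B1; lra.
  by move: aB; rewrite -a0' psi0// sqn0; nra.
have [e e0 He] := continuous_gt_near csq (lt_le_trans BN2 aB).
(* A time just before [a], kept nonnegative so that the a priori bound applies to it. *)
pose s := Num.max 0 (a - e / 2).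
have sa : s < a by rewrite /s gt_max a0/=; lra.
have s0 : 0 <= s by rewrite /s le_max lexx.
have : B < sqn (psi s).
  apply: He; rewrite ger0_norm; last by lra.
  have h : a - e / 2 <= s by rewrite /s le_max lexx orbT.
  by lra.
by rewrite ltNge leB.
Qed.
End truncation.

(** * Gluing the truncated solutions into the maximal solution *)

Lemma cvg_mx (R : realType) (d : nat) (T : Type) (F : set_system T) (FF : Filter F)
    (u : T -> 'M[R]_d) (A : 'M[R]_d) :
  (forall i j, u x i j @[x --> F] --> A i j) -> u x @[x --> F] --> A.
Proof.
move=> uA; apply/cvg_ballP => e e0.
have H : \forall x \near F, forall i j, ball (A i j) e (u x i j).
  apply: filter_forall => i; apply: filter_forall => j.
  by have /cvg_ballP := uA i j; apply.
by apply: filterS H => x Hx; split.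
Qed.

Lemma eq_volterra_at (R : realType) (d : nat) (f : 'M[R]_d -> 'M[R]_d)
    (K K' : R -> 'M[R]_d) (psi phi : R -> 'M[R]_d) (t : R) : 0 <= t ->
  (forall s, s \in `[0, t] -> K s = K' s) ->
  (forall s, s \in `[0, t] -> psi s = phi s) ->
  volterra_at f K psi t -> volterra_at f K' phi t.
Proof.
move=> t0 KK' psiphi [ipsi psiE].
have E s i j : s \in `[0, t] ->
    (f (psi (t - s)) *m K s) i j = (f (phi (t - s)) *m K' s) i j.
  move=> st; rewrite KK'// psiphi//.
  by move: st; rewrite !in_itv/= => /andP[? ?]; apply/andP; split; lra.
split.
  move=> i j; apply: eq_integrable (ipsi i j) => // s; rewrite inE/= => st.
  by rewrite E.
rewrite -psiphi ?psiE; last by rewrite in_itv/= t0 lexx.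
apply/matrixP => i j; rewrite !mxE; apply: eq_Rintegral => s; rewrite inE/= => st.
by rewrite E.
Qed.

Lemma eq_mx_in_L2 (R : realType) (d : nat) (T : R) (psi phi : R -> 'M[R]_d) :
  (forall s, s \in `[0, T] -> psi s = phi s) ->
  mx_in_L2 `[0, T] psi -> mx_in_L2 `[0, T] phi.
Proof.
move=> E /mx_in_L2E[mpsi Ipsi]; apply/mx_in_L2E; split.
  move=> i j; apply: eq_measurable_fun (mpsi i j) => s; rewrite inE/= => st.
  by rewrite E.
rewrite (_ : integral _ _ _ =
  \int[@lebesgue_measure R]_(t in `[0%R, T]) (sqn (psi t))%:E)%E//.
by apply: eq_integral => s; rewrite inE/= => st; rewrite E.
Qed.

Section noncontinuable.
Context {R : realType} {d : nat}.
Local Notation mu := (@lebesgue_measure R).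
Variable K : 'I_d -> R -> R.
Hypotheses (mK : forall j, measurable_fun [set: R] (K j)).
Hypotheses (K_neg : forall j s, s < 0 -> K j s = 0).
Hypotheses (K_L2 : forall j T,
  (\int[mu]_(s in `[0%R, T]) (K j s ^+ 2)%:E < +oo)%E).
Variables (f : 'M[R]_d -> 'M[R]_d) (C : R).
Hypotheses (C_ge0 : 0 <= C) (f_lipschitz : quadratic_lipschitz C f).

Theorem noncontinuable_solution_exists_unique :
  exists (psi : R -> 'M[R]_d) (Tmax : \bar R),
    [/\ continuous_until psi Tmax,
        noncontinuable_solution f (kernel_mx K) psi Tmax &
        unique_solution f (kernel_mx K) psi Tmax].
Proof.
(* Levels start at 1, so the truncated solutions, which are 0 at time 0, lie strictly below their
   level there; this yields [0 < Tmax]. *)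
have [Psi PsiT] : {Psi : nat -> R -> 'M[R]_d &
    forall n, truncated_solution K f n.+1%:R (Psi n)}.
  apply: (@boolp.choice _ _ (fun n => truncated_solution K f n.+1%:R)) => n.
  exact: (truncated_solution_exists mK K_neg K_L2 C_ge0 f_lipschitz).
have cPsi n i j : continuous (fun t => Psi n t i j) by have [] := PsiT n.
have Psi0 n t : t <= 0 -> Psi n t = 0 by have [_ + _] := PsiT n; apply.
(* The inequality is strict so that it persists slightly beyond [T]; hence the supremum [Tmax] is
   never attained. *)
pose good n T := forall t, t \in `[0, T] -> sqn (Psi n t) < n.+1%:R ^+ 2.
pose Tmax := ereal_sup [set T%:E | T in [set T | 0 <= T /\ exists n, good n T]].
(* Any level that is good up to [t] may be picked, since by uniqueness all of them give the same
   value. From [Tmax] on there is none, and the default level 0 is used. *)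
pose psi t := Psi (xget 0%N [set n | good n t]) t.
have good_le n T T' : T' <= T -> good n T -> good n T'.
  move=> TT gT t; rewrite in_itv/= => /andP[t0 tT]; apply: gT.
  by rewrite in_itv/=; apply/andP; split; lra.
have good_vol n T : good n T ->
    forall t, t \in `[0, T] -> volterra_at f (kernel_mx K) (Psi n) t.
  move=> gT t tT; apply: (truncated_solution_volterra mK K_L2 C_ge0 f_lipschitz _ (PsiT n)) => //.
  move=> s st; apply/ltW/gT; move: st tT; rewrite !in_itv/= => /andP[? ?] /andP[? ?].
  by apply/andP; split; lra.
have PsiL2 n T : mx_in_L2 `[0, T] (Psi n) by exact: continuous_mx_in_L2.
have uniq n n' T : 0 <= T -> good n T -> good n' T -> Psi n T = Psi n' T.
  move=> T0 gn gn'.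
  have TT : T \in `[0, T] by rewrite in_itv/= T0 lexx.
  have [_] := @volterra_unique R d K mK K_L2 f C C_ge0 f_lipschitz T (Psi n) (Psi n')
    (PsiL2 n T) (PsiL2 n' T) (ae_all (good_vol n T gn)) (ae_all (good_vol n' T gn')).
  by move/(_ T TT); apply; [exact: good_vol gn _ TT|exact: good_vol gn' _ TT].
have psiE n T : good n T -> forall t, t \in `[0, T] -> psi t = Psi n t.
  move=> gT t; rewrite in_itv/= => /andP[t0 tT].
  have gt : good n t by exact: good_le tT gT.
  apply: uniq => //; exact: (@xgetPex _ 0%N [set n | good n t] (ex_intro _ n gt)).
have extend n T : 0 <= T -> good n T -> exists2 T', T < T' & good n T'.
  move=> T0 gT.
  have gTT : sqn (Psi n T) < n.+1%:R ^+ 2 by apply: gT; rewrite in_itv/= T0 lexx.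
  have [e e0 He] := continuous_lt_near (continuous_sqn (cPsi n)) gTT.
  exists (T + e / 2); first by lra.
  move=> t; rewrite in_itv/= => /andP[t0 tT].
  have [tT'|tT'] := leP t T; first by apply: gT; rewrite in_itv/= t0.
  by apply: He; rewrite ltr0_norm; lra.
have good_lt n T : 0 <= T -> good n T -> (T%:E < Tmax)%E.
  move=> T0 gT; have [T' TT' gT'] := extend n T T0 gT.
  apply: (@lt_le_trans _ _ T'%:E); first by rewrite lte_fin.
  by apply: ereal_sup_ubound; exists T' => //; split; [lra|exists n].
have lt_good T : (T%:E < Tmax)%E -> exists T' n, T < T' /\ good n T'.
  move=> /ereal_sup_gt[_ [T' [T'0 [n gT']] <-]]; rewrite lte_fin => TT'.
  by exists T', n.
have cont : continuous_until psi Tmax.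
  apply/subspace_continuousP => t [t0 tT].
  have [T' [n [tT' gT']]] := lt_good t tT.
  have C1 : Psi n s @[s --> nbhs t] --> Psi n t by apply: cvg_mx => i j; exact: cPsi.
  rewrite /from_subspace (psiE n T' gT' t); last by rewrite in_itv/= t0 ltW.
  have C2 : Psi n s @[s --> within [set t : R | 0 <= t /\ (t%:E < Tmax)%E] (nbhs t)]
      --> Psi n t by apply: cvg_trans C1; apply: cvg_app; exact: cvg_within.
  have E : \forall s \near nbhs t, 0 <= s /\ (s%:E < Tmax)%E -> Psi n s = psi s.
    near=> s => -[s0 _]; rewrite (psiE n T')// in_itv/= s0/= ltW//.
    by near: s; exact: lt_nbhsl.
  by apply: cvg_trans C2; apply: near_eq_cvg; exact: E.
have reach T x : 0 < T -> mx_in_L2 `[0, T] x ->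
    {ae mu, forall t, t \in `[0, T] -> volterra_at f (kernel_mx K) x t} ->
    exists n, good n T.
  move=> T0 xL xv.
  have [N0 HN] := truncated_solution_reaches mK K_L2 C_ge0 f_lipschitz T0 xL xv.
  have [n Hn] : exists n : nat, N0 <= n.+1%:R.
    exists (Num.truncn N0); apply: ltW.
    have [N00|N00] := leP 0 N0; first exact: truncnS_gt.
    by apply: lt_le_trans N00 _.
  by exists n; exact: HN Hn (PsiT n).
have vol_psi t : 0 <= t -> (t%:E < Tmax)%E -> volterra_at f (kernel_mx K) psi t.
  move=> t0 /lt_good[T' [n [tT' gT']]].
  have gt : good n t by apply: good_le gT'; exact: ltW.
  apply: (@eq_volterra_at R d f (kernel_mx K) (kernel_mx K) (Psi n)) => //.
    by move=> s st; rewrite (psiE n t).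
  by apply: good_vol gt _ _; rewrite in_itv/= t0 lexx.
exists psi, Tmax; split => //.
- split => //.
  + by apply: (@good_lt 0%N) => // t; rewrite in_itv/= => /andP[t0 t0'];
      rewrite Psi0// sqn0 expr1n.
  + move=> T T0 /lt_good[T' [n [TT' gT']]].
    have gT : good n T by apply: good_le gT'; exact: ltW.
    by apply: eq_mx_in_L2 (PsiL2 n T) => s sT; rewrite (psiE n T).
  (* With finite norm, [psi] would itself be a competitor on [0, T], so some level would be good up
     to [T = Tmax]. *)
  + move=> T TE; apply/eqP; rewrite -leye_eq leNgt; apply/negP => fin.
    have T0 : 0 < T.
      rewrite -lte_fin -TE; apply: (@good_lt 0%N) => // t.
      by rewrite in_itv/= => /andP[t0 t0']; rewrite Psi0// sqn0 expr1n.
    have psiL : mx_in_L2 `[0, T] psi.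
      split => // i j; apply/measurable_fun_itv_bndo_bndcP.
      apply: subspace_continuous_measurable_fun => //.
      apply/subspace_continuousP => t; rewrite /= in_itv/= => /andP[t0 tT].
      have AE : [set s : R | 0 <= s /\ (s%:E < Tmax)%E] = `[0, T[%classic.
        apply/seteqP; split => s /=; rewrite TE lte_fin in_itv/=.
          by move=> [-> ->].
        by move=> /andP[].
      have /subspace_continuousP ct := cont; rewrite AE in ct.
      apply: (@cvg_comp _ _ _ psi (fun A : 'M[R]_d => A i j) _ (nbhs (psi t))).
        by apply: ct; rewrite /= in_itv/= t0.
      exact: coord_continuous.
    have vT : {ae mu, forall t, t \in `[0, T] -> volterra_at f (kernel_mx K) psi t}.
      (* The equation for [psi] is known only before [Tmax]; the endpoint is discarded as a null
         set. *)
      exists [set T]; split; [exact: measurable_set1|exact: lebesgue_measure_set1|].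
      move=> t /= nt; apply: contrapT => /eqP tT; apply: nt.
      rewrite in_itv/= => /andP[t0 tT']; apply: vol_psi => //.
      by rewrite TE lte_fin lt_neqAle tT.
    have [n gT] := reach T psi T0 psiL vT.
    by have := good_lt n T (ltW T0) gT; rewrite TE ltxx.
- move=> T phi T0 phiL phiv.
  have [n gT] := reach T phi T0 phiL phiv.
  have psiL : mx_in_L2 `[0, T] psi.
    by apply: eq_mx_in_L2 (PsiL2 n T) => s sT; rewrite (psiE n T).
  have TT := good_lt n T (ltW T0) gT.
  have vpsi t : t \in `[0, T] -> volterra_at f (kernel_mx K) psi t.
    rewrite in_itv/= => /andP[t0 tT]; apply: vol_psi => //.
    by apply: le_lt_trans TT; rewrite lee_fin.
  have [H1 H2] := @volterra_unique R d K mK K_L2 f C C_ge0 f_lipschitz T phi psi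
    phiL psiL phiv (ae_all vpsi).
  by split => // t tT vt; apply: H2 => //; exact: vpsi.
Unshelve. all: by end_near.
Qed.
End noncontinuable.

(** * The Riccati equation with a kernel given on the half-line *)

Theorem theorem6p4 (R : realType) (d : nat) (hd : (1 <= d)%N)
  (gamma : R) (hgamma : 0 < gamma < 1)
  (M Q Qt : 'M[R]_d) (rho v : 'cV[R]_d)
  (Kd : 'I_d -> R -> R)
  (hKeq : forall i j,
     {ae @lebesgue_measure R, forall s, 0 <= s -> Kd i s = Kd j s})
  (hKL2 : forall i (T : R), 0 < T -> in_L2 `[0, T] (Kd i))
  (hQt : Qt^T *m Qt =
     Q^T *m Q + (gamma / (1 - gamma)) *: (Q^T *m rho *m rho^T *m Q)) :
  let Mt := M + (gamma / (1 - gamma)) *: (Q^T *m rho *m v^T) in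
  let Gt := (gamma / (2 * (1 - gamma))) *: (v *m v^T) in
  let f := riccati Mt Qt Gt in
  let K := fun s : R => diag_mx (\row_i Kd i s) in
  exists (psi : R -> 'M[R]_d) (Tmax : \bar R),
    [/\ continuous_until psi Tmax,
        noncontinuable_solution f K psi Tmax &
        unique_solution f K psi Tmax].
Proof.
move=> Mt Gt f K.
have [C C0 fC] := riccati_quadratic_lipschitz Mt Qt Gt.
(* Values at negative times are replaced by 0, giving a kernel measurable on the whole line. The
   equation only evaluates it on [0, t], so solutions are unchanged. *)
pose K0 i := Kd i \_ `[0, +oo[.
have K0E i s : 0 <= s -> K0 i s = Kd i s.
  by move=> s0; rewrite /K0 patchT// mem_setE in_itv/= s0.
have mK0 i : measurable_fun [set: R] (K0 i).
  apply/(measurable_restrictT _ (measurable_itv _)).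
  rewrite itv_bndy_bigcup_BRight; apply/measurable_fun_bigcup => // n.
  (* The covering intervals have length [n], possibly 0, whereas [hKL2] asks for a positive
     length. *)
  have [+ _] := hKL2 i (n%:R + 1) (ltr_wpDl (ler0n _ _) ltr01).
  by apply: measurable_funS => //; apply: subset_itvl; rewrite bnd_simp; lra.
have K0_neg i s : s < 0 -> K0 i s = 0.
  by move=> s0; rewrite /K0 /patch mem_setE in_itv/= andbT leNgt s0.
have K0_L2 i T : (\int[@lebesgue_measure R]_(s in `[0%R, T]) (K0 i s ^+ 2)%:E < +oo)%E.
  have [|mK] := hKL2 i (Num.max T 1); first by rewrite lt_max ltr01 orbT.
  rewrite L2norm_on_lty; apply: le_lt_trans.
  rewrite (_ : integral _ _ _ =
    \int[@lebesgue_measure R]_(s in `[0%R, T]) (Kd i s ^+ 2)%:E)%E; last first.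
    apply: eq_integral => s; rewrite inE/= in_itv/= => /andP[s0 _].
    by rewrite K0E.
  apply: ge0_subset_integral => //.
  - by apply/measurable_EFinP; exact: measurable_funX.
  - by move=> s _; rewrite lee_fin sqr_ge0.
  - by apply: subset_itvl; rewrite bnd_simp le_max lexx.
have [psi [Tmax [cpsi [Tmax0 psiL psiV psi_oo] psiU]]] :=
  noncontinuable_solution_exists_unique mK0 K0_neg K0_L2 C0 fC.
have KE s : 0 <= s -> kernel_mx K0 s = K s.
  move=> s0; rewrite /kernel_mx /K; congr diag_mx; apply/rowP => i.
  by rewrite !mxE K0E.
have volE phi t : 0 <= t ->
    volterra_at f (kernel_mx K0) phi t <-> volterra_at f K phi t.
  by move=> t0; split; apply: eq_volterra_at => // s; rewrite in_itv/= => /andP[s0 _];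
    rewrite KE.
exists psi, Tmax; split; first exact: cpsi.
- split; [exact: Tmax0|exact: psiL| |exact: psi_oo].
  by move=> t t0 tT; apply/volE; [exact: t0|exact: psiV].
- move=> T phi T0 phiL phiV; have [|H1 H2 H3] := psiU T phi T0 phiL.
    apply: ae_sub phiV => t phit tT; apply/volE; last exact: phit.
    by move: tT; rewrite in_itv/= => /andP[].
  split; [exact: H1|exact: H2|move=> t tT phit].
  apply: (H3 t tT); apply/volE; last exact: phit.
  by move: tT; rewrite in_itv/= => /andP[].
Qed.
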